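(* There exists a positive $x \in \mathcal{A}_{\emptyset}$ such that there are no $g,h \in \mathcal{A}_{\emptyset}$, each expressible as a sum of squares, with $g \neq 0$, such that $gx = h$.
   Context: All graphs are finite and simple; $\emptyset$ denotes the graph with no vertices. For graphs $H,G$, $t(H;G)$ is the probability that a uniformly random map $V(H)\to V(G)$ is a homomorphism; $t(\emptyset;G)=1$. A partially labeled graph is a graph in which some vertices carry distinct positive-integer labels. $\mathcal{F}$ is the set of partially labeled graphs up to label-preserving isomorphism, and $\mathcal{F}_L$ those whose label set is exactly the finite set $L\subset\mathbb{N}$. The product $H_1\cdot H_2$ is the disjoint union with equally labeled vertices identified (multiple edges merged). $\mathbb{R}[\mathcal{F}]$ is the algebra of finite formal real linear combinations of elements of $\mathcal{F}$ with this product extended bilinearly, and $\mathbb{R}[\mathcal{F}_L]$ the subalgebra spanned by $\mathcal{F}_L$. For $H\in\mathcal{F}_L$, a graph $G$ and $\phi:L\to V(G)$, $t(H;G,\phi)$ is the probability that the map sending each labeled vertex with label $\ell$ to $\phi(\ell)$ and each unlabeled vertex to an independent uniform random vertex of $G$ is a homomorphism; this is extended linearly. Let $\mathcal{K}$ be the ideal generated by $F-\emptyset$ for $F$ a one-vertex (labeled or unlabeled) graph; $\mathcal{A}=\mathbb{R}[\mathcal{F}]/\mathcal{K}$, $\mathcal{A}_L=\mathbb{R}[\mathcal{F}_L]/(\mathcal{K}\cap\mathbb{R}[\mathcal{F}_L])$. An element $f\in\mathcal{A}_L$ is positive if $t(f;G,\phi)\ge0$ for all graphs $G$ and all $\phi:L\to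 V(G)$. For finite $T\subset\mathbb{N}$, $\llbracket\cdot\rrbracket_T$ is the linear map removing all labels not in $T$; $\llbracket\cdot\rrbracket:=\llbracket\cdot\rrbracket_\emptyset$. An element $y\in\mathcal{A}_\emptyset$ is expressible as a sum of squares if $y=\llbracket\sum_{i=1}^m g_i^2\rrbracket$ for some $g_1,\ldots,g_m\in\mathcal{A}$. *)

(* Defs.v *)
From Stdlib Require Import Reals.
From mathcomp Require Import all_boot.

Set Implicit Arguments.
Unset Strict Implicit.
Unset Printing Implicit Defensive.

(* Partially labeled graphs (concrete representatives).                *)
(* A representative is (V, E, Lab):                                    *)
(*   V   : duplicate-free list of vertex names (nat),                  *)
(*   E   : list of edges (u,v) (undirected: (u,v) and (v,u) same edge; *)
(*         repeated entries are merged),                               *)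
(*   Lab : list of (vertex, label) pairs, labels positive integers,    *)
(*         each vertex at most one label, labels pairwise distinct.    *)
(* Partially labeled graphs "up to label-preserving isomorphism" are   *)
(* obtained by quotienting by [pl_iso] (see [eqA] below).              *)

Definition pgraph := (seq nat * seq (nat * nat) * seq (nat * nat))%type.

Definition Vs (H : pgraph) : seq nat := H.1.1.
Definition Es (H : pgraph) : seq (nat * nat) := H.1.2.
Definition Ls (H : pgraph) : seq (nat * nat) := H.2.

Definition wf (H : pgraph) : bool :=
  [&& uniq (Vs H),
      all (fun e : nat * nat => [&& e.1 \in Vs H, e.2 \in Vs H & e.1 != e.2]) (Es H),
      all (fun p : nat * nat => (p.1 \in Vs H) && (0 < p.2)) (Ls H),
      uniq (map fst (Ls H)) &
      uniq (map snd (Ls H))].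

Definition adj (H : pgraph) (u v : nat) : bool :=
  ((u, v) \in Es H) || ((v, u) \in Es H).

Definition getlab (H : pgraph) (v : nat) : option nat :=
  ohead [seq p.2 | p <- Ls H & p.1 == v].

Definition labvert (H : pgraph) (a : nat) : option nat :=
  ohead [seq p.1 | p <- Ls H & p.2 == a].

Definition pl_iso (H H' : pgraph) : Prop :=
  exists f : nat -> nat,
    [/\ perm_eq (map f (Vs H)) (Vs H'),
        {in Vs H &, forall u v, adj H' (f u) (f v) = adj H u v} &
        {in Vs H, forall v, getlab H' (f v) = getlab H v}].

Definition empty_graph : pgraph := ([::], [::], [::]).

(* Product H1 . H2: disjoint union, equally labeled vertices identified,
   multiple edges merged.  Vertices of H2 that are not identified with a
   vertex of H1 are renamed v |-> N + v, with N larger than all of V(H1). *)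
Section Product.
Variables H1 H2 : pgraph.
Let N := (foldr maxn 0 (Vs H1)).+1.
Definition unmatched (v : nat) : bool :=
  match getlab H2 v with
  | Some a => labvert H1 a == None
  | None => true
  end.
Definition m2 (v : nat) : nat :=
  match getlab H2 v with
  | Some a => match labvert H1 a with Some u => u | None => N + v end
  | None => N + v
  end.
Definition pprod : pgraph :=
  (Vs H1 ++ [seq N + v | v <- Vs H2 & unmatched v],
   Es H1 ++ [seq (m2 e.1, m2 e.2) | e <- Es H2],
   Ls H1 ++ [seq (N + p.1, p.2) | p <- Ls H2 & unmatched p.1]).
End Product.

Definition unlabel (H : pgraph) : pgraph := (Vs H, Es H, [::]).

Definition fsum := seq (R * pgraph).

Local Open Scope R_scope.

Definition coef (f : fsum) (H : pgraph) : R :=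
  foldr (fun (p : R * pgraph) acc => ((if p.2 == H then p.1 else 0) + acc)) 0 f.

Definition fzero : fsum := [::].

Definition fmul (f g : fsum) : fsum :=
  [seq ((p.1 * q.1), pprod p.2 q.2) | p <- f, q <- g].

Definition funlabel (f : fsum) : fsum := [seq (p.1, unlabel p.2) | p <- f].

Definition sumsq (gs : seq fsum) : fsum := flatten [seq fmul g g | g <- gs].

Definition inF (f : fsum) : bool := all (fun p => wf p.2) f.
Definition inF0 (f : fsum) : bool := all (fun p => wf p.2 && (Ls p.2 == [::])) f.

(* Generators of the subspace by which we quotient the formal sums of
   representatives to get A = R[F]/K:
   - H - H' for isomorphic H, H' (identification up to isomorphism);
   - F.H - H for F a one-vertex graph (labeled or not): these span the
     ideal K generated by the F - emptyset. *)
Inductive gen := GIso of pgraph & pgraph | GK of pgraph & pgraph.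

Definition gen_ok (c : gen) : Prop :=
  match c with
  | GIso H H' => wf H /\ wf H' /\ pl_iso H H'
  | GK F H => wf F /\ wf H /\ size (Vs F) = 1%nat
  end.

Definition gen_vec (c : gen) : fsum :=
  match c with
  | GIso H H' => [:: (1, H); ((-1), H')]
  | GK F H => [:: (1, pprod F H); ((-1), H)]
  end.

Definition eqA (f g : fsum) : Prop :=
  exists cs : seq (R * gen),
    List.Forall (fun c => gen_ok c.2) cs /\
    forall H : pgraph,
      (coef f H - coef g H) =
      foldr (fun c acc => (c.1 * coef (gen_vec c.2) H + acc)) 0 cs.

(* A target graph G has vertex set {0,...,n-1} and symmetric,          *)
(* irreflexive adjacency adjG (values outside the range are ignored).  *)

Definition img (H : pgraph) (n : nat) (phi : {ffun 'I_(size (Vs H)) -> 'I_n})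
  (u : nat) : nat :=
  nth 0%nat [seq val (phi i) | i <- enum 'I_(size (Vs H))] (index u (Vs H)).

Definition homcount (H : pgraph) (n : nat) (adjG : nat -> nat -> bool) : nat :=
  #|[pred phi : {ffun 'I_(size (Vs H)) -> 'I_n} |
     all (fun e : nat * nat => adjG (img phi e.1) (img phi e.2)) (Es H)]|.

Definition tdens (H : pgraph) (n : nat) (adjG : nat -> nat -> bool) : R :=
  (INR (homcount H n adjG) / (INR n) ^ (size (Vs H))).

Definition tsum (f : fsum) (n : nat) (adjG : nat -> nat -> bool) : R :=
  foldr (fun p acc => (p.1 * tdens p.2 n adjG + acc)) 0 f.

Definition simple_graph (n : nat) (adjG : nat -> nat -> bool) : Prop :=
  (0 < n)%nat /\
  (forall i j, adjG i j = adjG j i) /\ (forall i, adjG i i = false).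

Definition positive0 (x : fsum) : Prop :=
  forall n adjG, simple_graph n adjG -> (0 <= tsum x n adjG).

Definition is_sos (y : fsum) : Prop :=
  exists gs : seq fsum, all inF gs /\ eqA y (funlabel (sumsq gs)).

(* Main.v *)
Require Import Defs.
From Stdlib Require Import Reals FunctionalExtensionality.
From mathcomp Require Import all_boot all_order all_algebra.
From mathcomp Require Import Rstruct ring lra zify.

(** For a vertex [y] let [a], [e], [t] be the densities of edges, triangles and
    [K_4]'s rooted at [y], [q = a^2 - e] and [d = a t - 2 e^2 + a^2 e].  The
    number [k = a^2 / q] is the number of parts when the neighbourhood of [y]
    is a balanced complete multipartite graph, in which case [d = 0]; in
    general [d >= 0], and Bollobas' chord inequality bounds [d a^4 / q^4] below
    by [f (1 - f)] where [f] is the fractional part of [k].  Hence, for two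
    roots with parameters [k] and [l], the integer inequality
    [(k - l)(k - l - 1) >= 0] becomes true for all graphs once these two
    penalties are added; clearing denominators and averaging over the roots
    gives the positive element [witness].

    Sums of squares cannot see that a number of parts is an integer.  The
    densities of a graph having [kappa] equal parts among its pieces are
    polynomials in [kappa], and for real [kappa] at least the number of labels
    they still define a multiplicative functional which is nonnegative on sums
    of squares: the weights of the label patterns are falling factorials of
    [kappa].  On the disjoint union of a complete [(l + 3/2)]-partite and a
    complete [(l + 1)]-partite piece, [witness] is negative, hence also after
    adding a small multiple [eps] of an arbitrary graph [W].  If [g x = h] with
    [g], [h] sums of squares, then [g] vanishes for all small [eps], hence,
    being polynomial in [eps], also at [eps = 1], that is on [W]; and an
    element vanishing on all [W] is zero. *)

Set Implicit Arguments.
Unset Strict Implicit.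
Unset Printing Implicit Defensive.

Import Order.TTheory GRing.Theory Num.Theory.
Local Open Scope ring_scope.

(* Otherwise terms of type [R] are read in the scope of the standard library. *)
Bind Scope ring_scope with R.

(** * Iterated integrals over vertex assignments *)

Definition upd (C : Type) (rho : nat -> C) (v : nat) (c : C) : nat -> C :=
  fun w => if w == v then c else rho w.

Lemma updC (C : Type) (rho : nat -> C) v w c d : v != w ->
  upd (upd rho v c) w d = upd (upd rho w d) v c.
Proof.
move=> nvw; apply: functional_extensionality => z; rewrite /upd.
by case: (z =P w) => // ->; rewrite eq_sym (negbTE nvw).
Qed.

Definition depends_on (C : Type) (D : seq nat) (F : (nat -> C) -> R) :=
  forall rho rho', {in D, rho =1 rho'} -> F rho = F rho'.

(** The list [ms] is a finitely supported measure on [C]. Its total mass is left arbitrary, because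
    identities in the number of parts are checked at integers, where the mass is in general not
    1. *)
Fixpoint integ (C : Type) (ms : seq (R * C)) (V : seq nat)
    (F : (nat -> C) -> R) (rho : nat -> C) : R :=
  if V is v :: V' then
    \sum_(p <- ms) p.1 * integ ms V' F (upd rho v p.2)
  else F rho.

Definition homind (C : Type) (A : C -> C -> bool) (E : seq (nat * nat))
    (rho : nat -> C) : R :=
  (all (fun e => A (rho e.1) (rho e.2)) E)%:R.

Section Integ.
Variables (C : Type) (ms : seq (R * C)).
Implicit Types (V D : seq nat) (F G : (nat -> C) -> R) (rho : nat -> C).

Let mass : R := \sum_(p <- ms) p.1.

Lemma eq_integ V F G rho : F =1 G -> integ ms V F rho = integ ms V G rho.
Proof.
move=> FG; elim: V rho => [|v V IH] rho /=; first exact: FG.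
by apply: eq_bigr => p _; rewrite IH.
Qed.

Lemma integ_cat V1 V2 F rho :
  integ ms (V1 ++ V2) F rho = integ ms V1 (integ ms V2 F) rho.
Proof.
elim: V1 rho => //= v V1 IH rho.
by apply: eq_bigr => p _; rewrite IH.
Qed.

Lemma depends_integ D V F rho rho' : depends_on D F ->
  (forall w, w \in D -> w \notin V -> rho w = rho' w) ->
  integ ms V F rho = integ ms V F rho'.
Proof.
move=> dF; elim: V rho rho' => [|v V IH] rho rho' e /=.
  by apply: dF => w wD; apply: e.
apply: eq_bigr => p _; congr (_ * _); apply: IH => w wD wV.
rewrite /upd; case: (w =P v) => [//|/eqP nwv].
by apply: e => //; rewrite inE negb_or nwv.
Qed.

Lemma integ_mull V F G rho :
  (forall v c rho, v \in V -> G (upd rho v c) = G rho) ->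
  integ ms V (fun rho => G rho * F rho) rho = G rho * integ ms V F rho.
Proof.
elim: V rho => [//|v V IH] rho hG /=.
rewrite big_distrr /=; apply: eq_bigr => p _.
rewrite IH => [|w c r wV]; last by apply: hG; rewrite inE wV orbT.
by rewrite hG ?mem_head //; ring.
Qed.

Lemma integ_const V rho : integ ms V (fun=> 1) rho = mass ^+ size V.
Proof.
elim: V rho => [|v V IH] rho /=; first by rewrite expr0.
under eq_bigr do rewrite IH.
by rewrite -mulr_suml exprS.
Qed.

Lemma integ_rename (tau : nat -> nat) D V F rho :
  depends_on D F -> {subset V <= D} -> {in D &, injective tau} ->
  integ ms (map tau V) (fun rho => F (rho \o tau)) rho
  = integ ms V F (rho \o tau).
Proof.
move=> dF + tau_inj; elim: V rho => [//|v V IH] rho sVD /=.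
apply: eq_bigr => p _; rewrite IH => [|w wV]; last first.
  by apply: sVD; rewrite inE wV orbT.
congr (_ * _); apply: (depends_integ dF) => w wD _ /=.
rewrite /upd /=; case: (w =P v) => [->|nwv]; first by rewrite eqxx.
case: eqP => // /tau_inj e; case: nwv; apply: e => //.
by apply: sVD; rewrite mem_head.
Qed.

Lemma integ_swap v w V F rho :
  integ ms (v :: w :: V) F rho = integ ms (w :: v :: V) F rho.
Proof.
have [->//|nvw] := eqVneq v w.
rewrite /=.
under eq_bigr do rewrite big_distrr /=.
under [RHS]eq_bigr do rewrite big_distrr /=.
rewrite exchange_big /=; apply: eq_bigr => p _; apply: eq_bigr => q _.
by rewrite (updC _ _ _ nvw); ring.
Qed.

Lemma integ_front v V F rho : v \in V ->
  integ ms V F rho = integ ms (v :: rem v V) F rho.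
Proof.
elim: V rho => [//|w V IH] rho; rewrite inE /=.
have [->//|nvw] /= := eqVneq v w => vV.
rewrite -[RHS]/(integ ms (v :: w :: rem v V) F rho) integ_swap.
by apply: eq_bigr => p _; rewrite (IH _ vV).
Qed.

Lemma integ_perm V V' F rho : perm_eq V V' ->
  integ ms V F rho = integ ms V' F rho.
Proof.
elim: V V' rho => [|v V IH] V' rho pV.
  by move: pV; rewrite perm_sym => /perm_nilP ->.
have vV' : v \in V' by rewrite -(perm_mem pV) mem_head.
rewrite (integ_front _ _ vV') /=; apply: eq_bigr => p _.
rewrite (IH (rem v V')) // -(perm_cons v).
by apply: perm_trans pV _; apply: perm_to_rem.
Qed.

Lemma integ_shift (phi : C -> C) V F rho :
  (forall f : C -> R, \sum_(p <- ms) p.1 * f (phi p.2) = \sum_(p <- ms) p.1 * f p.2) ->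
  (forall rho, F (phi \o rho) = F rho) ->
  integ ms V F (phi \o rho) = integ ms V F rho.
Proof.
move=> hm hF; elim: V rho => [//|v V IH] rho /=.
rewrite -(hm (fun c => integ ms V F (upd (phi \o rho) v c))).
apply: eq_bigr => p _; congr (_ * _); rewrite -[in RHS]IH; congr integ.
by apply: functional_extensionality => w; rewrite /upd /=; case: (w == v).
Qed.

End Integ.

Section Homind.
Variables (C : Type) (A : C -> C -> bool).

Lemma homind_cat E1 E2 rho :
  homind A (E1 ++ E2) rho = homind A E1 rho * homind A E2 rho.
Proof. by rewrite /homind all_cat -natrM mulnb. Qed.

Lemma homind_map (tau : nat -> nat) E rho :
  homind A [seq (tau e.1, tau e.2) | e <- E] rho = homind A E (rho \o tau).
Proof. by rewrite /homind all_map. Qed.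

Lemma depends_homind D E :
  all (fun e : nat * nat => (e.1 \in D) && (e.2 \in D)) E ->
  depends_on D (homind A E).
Proof.
move=> /allP hE rho rho' e; rewrite /homind; congr (nat_of_bool _)%:R.
by apply: eq_in_all => f /hE/andP[h1 h2]; rewrite !e.
Qed.

End Homind.

(** * Labels and products of partially labeled graphs *)

Definition labs (H : pgraph) : seq nat := map snd (Ls H).
Definition unlabeled (H : pgraph) : seq nat :=
  [seq v <- Vs H | getlab H v == None].

Lemma ohead_cat (T : Type) (s t : seq T) :
  ohead (s ++ t) = if ohead s is Some a then Some a else ohead t.
Proof. by case: s. Qed.

Lemma ohead_mem (T : eqType) (s : seq T) x : ohead s = Some x -> x \in s.
Proof. by case: s => //= y s [->]; rewrite mem_head. Qed.

Section WellFormed.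
Variable H : pgraph.
Hypothesis wfH : wf H.

Lemma wf_uniq : uniq (Vs H). Proof. by case/and5P: wfH. Qed.

Lemma wf_edges : all (fun e : nat * nat => (e.1 \in Vs H) && (e.2 \in Vs H)) (Es H).
Proof.
case/and5P: wfH => _ hE _ _ _; apply: sub_all hE => e.
by case/and3P=> -> ->.
Qed.

Lemma getlabP v a : reflect (getlab H v = Some a) ((v, a) \in Ls H).
Proof.
case/and5P: wfH => _ _ _ u1 _; apply: (iffP idP) => [|].
  rewrite /getlab; elim: (Ls H) u1 => //= [[w b]] s IH /= /andP[nw us].
  rewrite inE xpair_eqE; case: (eqVneq w v) => [ew|nwv] /=.
    move=> /orP[/eqP->//|vs].
    by case/negP: nw; rewrite ew; apply/mapP; exists (v, a).
  by apply: IH.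
move=> /ohead_mem/mapP[[w b]] /=; rewrite mem_filter /= => /andP[/eqP-> i] ->.
exact: i.
Qed.

Lemma labvertP a v : reflect (labvert H a = Some v) ((v, a) \in Ls H).
Proof.
case/and5P: wfH => _ _ _ _ u2; apply: (iffP idP) => [|].
  rewrite /labvert; elim: (Ls H) u2 => //= [[w b]] s IH /= /andP[nw us].
  rewrite inE xpair_eqE; case: (eqVneq b a) => [ew|nwv] /=.
    rewrite ?andbT => /orP[/eqP->//|vs].
    by case/negP: nw; rewrite ew; apply/mapP; exists (v, a).
  by rewrite andbF; apply: IH.
move=> /ohead_mem/mapP[[w b]] /=; rewrite mem_filter /= => /andP[/eqP-> i] ->.
exact: i.
Qed.

Lemma getlab_labvert v a : getlab H v = Some a <-> labvert H a = Some v.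
Proof. by split; [move/getlabP/labvertP | move/labvertP/getlabP]. Qed.

Lemma getlab_mem v a : getlab H v = Some a -> v \in Vs H.
Proof. by move/getlabP; case/and5P: wfH => _ _ /allP h _ _ /h /andP[]. Qed.

Lemma getlab_inj v w a : getlab H v = Some a -> getlab H w = Some a -> v = w.
Proof. by move=> /getlab_labvert e /getlab_labvert; rewrite e => -[]. Qed.

Lemma labs_uniq : uniq (labs H). Proof. by case/and5P: wfH. Qed.

Lemma mem_labs a : reflect (exists v, getlab H v = Some a) (a \in labs H).
Proof.
apply: (iffP mapP) => [[[v b] i /= ->]|[v /getlabP i]].
  by exists v; apply/getlabP.
by exists (v, a).
Qed.

End WellFormed.

Lemma Ls_pprod0 H1 H2 : Ls H1 = [::] -> Ls H2 = [::] -> Ls (pprod H1 H2) = [::].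
Proof. by move=> l1 l2; rewrite /Ls /= l1 l2. Qed.

Section PProdFacts.
Variables H1 H2 : pgraph.
Hypotheses (wf1 : wf H1) (wf2 : wf H2).

Let N := (foldr maxn 0 (Vs H1)).+1.

Lemma Vs_ltN v : v \in Vs H1 -> (v < N)%N.
Proof.
rewrite /N ltnS; elim: (Vs H1) => //= w s IH; rewrite inE leq_max.
by case/predU1P => [->|/IH ->]; rewrite ?leqnn ?orbT.
Qed.

Lemma addN_nlt w : ~~ (N + w < N)%N.
Proof. by rewrite -leqNgt leq_addr. Qed.

Lemma getlab_pprodl v : v \in Vs H1 -> getlab (pprod H1 H2) v = getlab H1 v.
Proof.
move=> vV; rewrite /getlab /pprod /Ls /= filter_cat map_cat ohead_cat.
case: (ohead _) => //.
rewrite filter_map (eq_in_filter (a2 := pred0)) ?filter_pred0 //.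
move=> p _ /=; apply/eqP => e; have := Vs_ltN vV.
by rewrite -e; apply/negP/addN_nlt.
Qed.

Lemma getlab_pprodr v : unmatched H1 H2 v ->
  getlab (pprod H1 H2) (N + v)%N = getlab H2 v.
Proof.
move=> um; rewrite /getlab /pprod /Ls /= filter_cat map_cat ohead_cat.
rewrite (eq_in_filter (a2 := pred0)) ?filter_pred0 /=; last first.
  move=> p hp /=; apply/eqP => e.
  have : p.1 \in Vs H1 by case/and5P: wf1 => _ _ /allP h _ _; case/andP: (h _ hp).
  by move/Vs_ltN; rewrite e; apply/negP/addN_nlt.
rewrite filter_map -filter_predI -map_comp; congr ohead.
have -> : [seq p <- H2.2 | predI (preim (fun p : nat * nat => ((foldr maxn 0 (Vs H1)).+1 + p.1, p.2)%N)
            (fun p : nat * nat => p.1 == (N + v)%N))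
            (fun p : nat * nat => unmatched H1 H2 p.1) p] = [seq p <- H2.2 | p.1 == v].
  apply: eq_filter => p /=; rewrite eqn_add2l.
  by case: eqP => //= ->; rewrite um.
exact: eq_map.
Qed.

Lemma m2_unlabeled v : getlab H2 v = None -> m2 H1 H2 v = (N + v)%N.
Proof. by rewrite /m2 => ->. Qed.

Lemma m2_unmatched v : unmatched H1 H2 v -> m2 H1 H2 v = (N + v)%N.
Proof.
rewrite /m2 /unmatched; case: (getlab H2 v) => // a.
by case: (labvert H1 a).
Qed.

Lemma m2_matched v : ~~ unmatched H1 H2 v ->
  exists a u, [/\ getlab H2 v = Some a, getlab H1 u = Some a & m2 H1 H2 v = u].
Proof.
rewrite /m2 /unmatched; case: (getlab H2 v) => // a.
case e: (labvert H1 a) => [u|] // _; exists a, u; split=> //.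
exact/(getlab_labvert wf1).
Qed.

Lemma m2_inj : {in Vs H2 &, injective (m2 H1 H2)}.
Proof.
move=> v w vV wV.
have [uv|/m2_matched[a [u [e1 e2 ->]]]] := boolP (unmatched H1 H2 v);
have [uw|/m2_matched[b [u' [e1' e2' ->]]]] := boolP (unmatched H1 H2 w).
- by rewrite !m2_unmatched // => /addnI.
- rewrite m2_unmatched // => e; have := Vs_ltN (getlab_mem wf1 e2').
  by rewrite -e => /(negP (addN_nlt _)).
- rewrite m2_unmatched // => e; have := Vs_ltN (getlab_mem wf1 e2).
  by rewrite e => /(negP (addN_nlt _)).
- move=> e; rewrite -e e2 in e2'; case: e2' => e3.
  by apply: (getlab_inj wf2 e1); rewrite e1' e3.
Qed.

Lemma m2_mem v : v \in Vs H2 -> m2 H1 H2 v \in Vs (pprod H1 H2).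
Proof.
move=> vV; rewrite mem_cat; case: (boolP (unmatched H1 H2 v)) => [uv|].
  by rewrite m2_unmatched //; apply/orP; right; apply/mapP; exists v; rewrite ?mem_filter ?uv.
by case/m2_matched => a [u [_ e ->]]; rewrite (getlab_mem wf1 e).
Qed.

Lemma unlabeled_pprod :
  unlabeled (pprod H1 H2) = unlabeled H1 ++ map (m2 H1 H2) (unlabeled H2).
Proof.
rewrite /unlabeled /pprod /Vs /= filter_cat -/(pprod H1 H2); congr (_ ++ _).
  by apply: eq_in_filter => v vV; rewrite getlab_pprodl.
rewrite filter_map -filter_predI.
have -> : [seq v <- H2.1.1 | predI (preim [eta addn (foldr maxn 0 H1.1.1).+1]
    (fun v : nat => getlab (pprod H1 H2) v == None)) (fun v : nat => unmatched H1 H2 v) v]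
   = [seq v <- H2.1.1 | getlab H2 v == None].
  apply: eq_filter => v /=; case: (boolP (unmatched H1 H2 v)) => uv.
    by rewrite getlab_pprodr ?andbT.
  by case/m2_matched: uv => a [u [-> _ _]]; rewrite andbF.
apply/eq_in_map => v; rewrite mem_filter => /andP[/eqP e _].
by rewrite m2_unlabeled.
Qed.

Lemma wf_pprod : wf (pprod H1 H2).
Proof.
have sub1 v : v \in Vs H1 -> v \in Vs (pprod H1 H2) by rewrite mem_cat => ->.
have um_lab v a : unmatched H1 H2 v -> getlab H2 v = Some a -> a \notin labs H1.
  rewrite /unmatched => + e; rewrite e => /eqP lv.
  by apply/negP => /(mem_labs wf1) [w /(getlab_labvert wf1)]; rewrite lv.
apply/and5P; split.
- rewrite cat_uniq (wf_uniq wf1) /=; apply/andP; split.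
    apply/hasPn => _ /mapP[v _ ->]; apply/negP => /Vs_ltN.
    exact/negP/addN_nlt.
  by rewrite map_inj_uniq ?filter_uniq ?(wf_uniq wf2) // => v w /addnI.
- rewrite all_cat; apply/andP; split.
    case/and5P: wf1 => _ + _ _ _; apply: sub_all => e /and3P[h1 h2 ->].
    by rewrite !sub1.
  rewrite all_map; case/and5P: wf2 => _ + _ _ _; apply: sub_all => e /and3P[h1 h2 h3] /=.
  by rewrite !m2_mem //=; apply/eqP => /(m2_inj h1 h2) e'; rewrite e' eqxx in h3.
- rewrite all_cat; apply/andP; split.
    case/and5P: wf1 => _ _ + _ _; apply: sub_all => p /andP[h1 ->].
    by rewrite sub1.
  rewrite all_map all_filter; case/and5P: wf2 => _ _ + _ _; apply: sub_all => p /andP[h1 h2] /=.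
  apply/implyP => up; rewrite /= h2 andbT mem_cat; apply/orP; right.
  by apply/mapP; exists p.1; rewrite ?mem_filter ?up.
- rewrite map_cat cat_uniq; case/and5P: (wf1) => _ _ /allP h1 -> _ /=.
  apply/andP; split.
    apply/hasPn => x; rewrite -map_comp => /mapP[p _ -> /=].
    apply/negP => /mapP[p' /h1/andP[h _] e]; have := Vs_ltN h.
    by rewrite -e; apply/negP/addN_nlt.
  rewrite -map_comp; have -> : [seq (fst \o (fun p : nat * nat => ((foldr maxn 0 (Vs H1)).+1 + p.1, p.2)%N)) i |
     i <- Ls H2 & unmatched H1 H2 i.1] = map (addn N) (map fst [seq p <- Ls H2 | unmatched H1 H2 p.1]).
    by rewrite -map_comp.
  rewrite map_inj_uniq; last by move=> v w /addnI.
  case/and5P: wf2 => _ _ _ + _; apply: subseq_uniq.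
  exact: map_subseq (filter_subseq _ _).
- rewrite map_cat cat_uniq -/(labs H1) labs_uniq //=; apply/andP; split.
    apply/hasPn => x; rewrite -map_comp => /mapP[[v a]].
    rewrite mem_filter /= => /andP[uv i] ->.
    by apply: (um_lab v) => //; apply/(getlabP wf2).
  rewrite -map_comp.
  case/and5P: wf2 => _ _ _ _; apply: subseq_uniq.
  exact: map_subseq (filter_subseq _ _).
Qed.

Lemma labs_pprod : {subset labs (pprod H1 H2) <= labs H1 ++ labs H2}.
Proof.
move=> a; rewrite /labs /pprod /Ls /= map_cat !mem_cat => /orP[-> //|].
rewrite -map_comp => /mapP[p]; rewrite mem_filter => /andP[_ i] ->.
by apply/orP; right; apply/mapP; exists p.
Qed.

End PProdFacts.

(** * Labeled densities in a finite weighted model *)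

Lemma map_uniq_inj (T U : eqType) (f : T -> U) (s : seq T) :
  uniq (map f s) -> {in s &, injective f}.
Proof.
elim: s => //= x s IH /andP[nx us] y z; rewrite !inE.
case/predU1P => [->|ys] /predU1P[->|zs] e //; last exact: IH.
  by case/negP: nx; rewrite e map_f.
by case/negP: nx; rewrite -e map_f.
Qed.

Section Density.
Variables (C : Type) (ms : seq (R * C)) (A : C -> C -> bool) (c0 : C).
Implicit Types (H : pgraph) (psi rho : nat -> C).

Definition lasg H psi : nat -> C :=
  fun v => if getlab H v is Some a then psi a else c0.

Definition dens H : R := integ ms (Vs H) (homind A (Es H)) (fun=> c0).
Definition ldens H psi : R :=
  integ ms (unlabeled H) (homind A (Es H)) (lasg H psi).

Lemma depends_wf H : wf H -> depends_on (Vs H) (homind A (Es H)).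
Proof. by move=> wfH; apply/depends_homind/wf_edges. Qed.

Lemma dens_indep H rho : wf H ->
  dens H = integ ms (Vs H) (homind A (Es H)) rho.
Proof.
by move=> wfH; apply: (depends_integ _ (depends_wf wfH)) => w ->.
Qed.

(** Once the labeled vertices are fixed, the unlabeled vertices of the two factors are distinct and
    are integrated independently. *)
Lemma ldens_pprod H1 H2 psi : wf H1 -> wf H2 ->
  ldens (pprod H1 H2) psi = ldens H1 psi * ldens H2 psi.
Proof.
move=> wf1 wf2; rewrite /ldens unlabeled_pprod // integ_cat.
set rho := lasg _ _; set tau := m2 H1 H2.
set U1 := unlabeled H1; set U2 := unlabeled H2.
have U2V : {subset U2 <= Vs H2} by move=> v; rewrite mem_filter => /andP[].
have inner r : integ ms (map tau U2) (homind A (Es (pprod H1 H2))) r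
    = integ ms U2 (homind A (Es H2)) (r \o tau) * homind A (Es H1) r.
  under eq_integ do rewrite homind_cat homind_map.
  rewrite integ_mull => [|v c r' /mapP[w wU ->]].
    by rewrite mulrC (integ_rename _ _ (depends_wf wf2)) //; apply: m2_inj.
  apply: (depends_wf wf1) => z zV; rewrite /upd; case: eqP => // e.
  have := Vs_ltN zV; rewrite e /tau m2_unlabeled; first by move/(negP (addN_nlt _ _)).
  by move: wU; rewrite mem_filter => /andP[/eqP].
rewrite (eq_integ _ _ _ inner) (@integ_mull _ _ _ _ (fun r => integ ms U2 (homind A (Es H2)) (r \o tau))).
  rewrite mulrC; congr (_ * _).
    apply: (depends_integ _ (depends_wf wf1)) => v vV _.
    by rewrite /rho /lasg getlab_pprodl.
  apply: (depends_integ _ (depends_wf wf2)) => v vV vU.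
  have [a e] : exists a, getlab H2 v = Some a.
    by move: vU; rewrite mem_filter vV andbT; case: (getlab H2 v) => // a _; exists a.
  rewrite /= /rho /lasg e /tau.
  case: (boolP (unmatched H1 H2 v)) => [uv|/(m2_matched wf1)[b [u [e1 e2 ->]]]].
    by rewrite m2_unmatched // getlab_pprodr // e.
  by rewrite getlab_pprodl ?(getlab_mem wf1 e2) // e2; congr psi; move: e1; rewrite e => -[].
(* The second factor does not see an unlabeled vertex of [H1]: its labeled vertices land either
   above all vertices of [H1] or on labeled ones. *)
move=> v c r vU; apply: (depends_integ _ (depends_wf wf2)) => w wV wU /=.
rewrite /upd; case: eqP => // e; move: vU; rewrite -e mem_filter => /andP[/eqP l i].
case: (boolP (unmatched H1 H2 w)) => [uw|/(m2_matched wf1)[b [u [e1 e2 e3]]]].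
  by move: i; rewrite /tau m2_unmatched // => /Vs_ltN/(negP (addN_nlt _ _)).
by move: l; rewrite /tau e3 e2.
Qed.

Lemma depends_ldens H : wf H -> depends_on (labs H) (ldens H).
Proof.
move=> wfH psi psi' e; apply: (depends_integ _ (depends_wf wfH)) => v vV _.
rewrite /lasg; case e1: (getlab H v) => [a|] //; apply: e.
by apply/(mem_labs wfH); exists v.
Qed.

(** Integrating over the labels of [H] completes the labeled density to an integral over all
    vertices; every other label in [Ls] contributes a factor equal to the total mass. *)
Lemma integ_ldens H Ls psi : wf H -> uniq Ls -> {subset labs H <= Ls} ->
  integ ms Ls (ldens H) psi
  = (\sum_(p <- ms) p.1) ^+ (size Ls - size (labs H)) * dens H.
Proof.
move=> wfH uL sL; set rest := [seq a <- Ls | a \notin labs H].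
have pL : perm_eq Ls (labs H ++ rest).
  apply: uniq_perm => //; last first.
    move=> a; rewrite mem_cat mem_filter; have := sL a.
    by case: (a \in labs H) => //= ->.
  rewrite cat_uniq labs_uniq ?filter_uniq //= andbT.
  by apply/hasPn => a; rewrite mem_filter => /andP[].
have -> : (size Ls - size (labs H) = size rest)%N.
  by rewrite (perm_size pL) size_cat addKn.
rewrite (integ_perm _ _ _ pL) integ_cat.
under eq_integ => r.
  under eq_integ do rewrite -[ldens H _]mulr1.
  rewrite integ_mull.
    rewrite integ_const mulrC.
  over.
  move=> a c r' ha; apply: (depends_ldens wfH) => b hb; rewrite /upd.
  by case: eqP => // e; move: ha; rewrite -e mem_filter hb.
rewrite integ_mull //; congr (_ * _).
set lv := map fst (Defs.Ls H).
pose tau v := odflt 0%N (getlab H v).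
have lvP v : (v \in lv) = (getlab H v != None).
  apply/mapP/idP => [[[w a] i /= ->]|].
    by move/(getlabP wfH): i => ->.
  by case e: (getlab H v) => [a|] // _; exists (v, a) => //; apply/(getlabP wfH).
have labsE : labs H = map tau lv.
  rewrite -map_comp; apply/eq_in_map => -[v a] i /=.
  by rewrite /tau; move/(getlabP wfH): i => ->.
(* [F] sees only labeled vertices, on which the map [tau] to labels is injective, so integrating
   over labels is integrating over labeled vertices. *)
pose F := integ ms (unlabeled H) (homind A (Es H)).
have dF : depends_on lv F.
  move=> r r' e; apply: (depends_integ _ (depends_wf wfH)) => w wV.
  rewrite mem_filter wV andbT => h; apply: e; by rewrite lvP.
rewrite (@eq_integ _ _ _ _ (fun psi => F (psi \o tau))); last first.
  move=> r; apply: dF => v; rewrite lvP /lasg /tau /=.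
  by case: (getlab H v).
rewrite labsE (integ_rename _ _ dF) //; last first.
  move=> v w; rewrite !lvP /tau; case e1: (getlab H v) => [a|] //.
  case e2: (getlab H w) => [b|] //= _ _ ab.
  by apply: (getlab_inj wfH e1); rewrite e2 ab.
rewrite -integ_cat (dens_indep (psi \o tau) wfH); apply: integ_perm.
apply: uniq_perm; last 1 first.
- move=> v; rewrite mem_cat lvP mem_filter.
  case e: (getlab H v) => [a|] //=.
  by rewrite (getlab_mem wfH e).
- rewrite cat_uniq; case/and5P: (wfH) => uV _ _ -> _ /=.
  rewrite filter_uniq // andbT; apply/hasPn => v.
  by rewrite mem_filter lvP => /andP[/eqP ->].
- exact: wf_uniq.
Qed.

(** The isomorphism is a change of integration variables. Symmetry of [A] enters because the two
    edge lists may orient the same edge differently. *)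
Lemma dens_iso H H' : symmetric A -> wf H -> wf H' -> pl_iso H H' -> dens H = dens H'.
Proof.
move=> symA wfH wfH' [f [pf adjf _]].
have finj : {in Vs H &, injective f}.
  by apply: map_uniq_inj; rewrite (perm_uniq pf) wf_uniq.
have homE r : homind A (Es H') r = homind A (Es H) (r \o f).
  congr (nat_of_bool _)%:R; apply/allP/allP => h [u v] /= i.
    have /andP[/= uV vV] := allP (wf_edges wfH) _ i.
    have : adj H' (f u) (f v) by rewrite adjf // /adj i.
    by case/orP => /h //=; rewrite symA.
  have /andP[/= uV vV] := allP (wf_edges wfH') _ i.
  move: uV vV; rewrite -!(perm_mem pf) => /mapP[u' uV' eu] /mapP[v' vV' ev].
  have : adj H u' v' by rewrite -adjf // /adj -eu -ev i.
  by rewrite eu ev; case/orP => /h //=; rewrite symA.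
rewrite [RHS]/dens -(integ_perm _ _ _ pf) (eq_integ _ _ _ homE).
by rewrite (integ_rename _ _ (depends_wf wfH)).
Qed.

End Density.

(** * Interpolating the number of parts *)

Definition ispoly (f : R -> R) := exists p : {poly R}, forall s, f s = p.[s].

Lemma ispoly_const c : ispoly (fun=> c).
Proof. by exists c%:P => s; rewrite hornerC. Qed.

Lemma ispoly_id : ispoly id.
Proof. by exists 'X => s; rewrite hornerX. Qed.

Lemma ispolyD f g : ispoly f -> ispoly g -> ispoly (fun s => f s + g s).
Proof. by move=> [p hp] [q hq]; exists (p + q) => s; rewrite hornerD hp hq. Qed.

Lemma ispolyM f g : ispoly f -> ispoly g -> ispoly (fun s => f s * g s).
Proof. by move=> [p hp] [q hq]; exists (p * q) => s; rewrite hornerM hp hq. Qed.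

Lemma ispolyX f n : ispoly f -> ispoly (fun s => f s ^+ n).
Proof. by move=> [p hp]; exists (p ^+ n) => s; rewrite horner_exp hp. Qed.

Lemma ispoly_sum (T : Type) (r : seq T) (F : T -> R -> R) :
  (forall i, ispoly (F i)) -> ispoly (fun s => \sum_(i <- r) F i s).
Proof.
move=> hF; elim: r => [|i r IH].
  by have [p hp] := ispoly_const 0; exists p => s; rewrite big_nil.
have [p hp] := ispolyD (hF i) IH; exists p => s; by rewrite big_cons.
Qed.

Lemma poly_eq0_infinite (p : {poly R}) (u : nat -> R) : injective u ->
  (forall k, p.[u k] = 0) -> p = 0.
Proof.
move=> u_inj hp; apply/eqP/negPn/negP => np.
have hr : all (root p) (map u (iota 0 (size p))).
  by apply/allP => _ /mapP[k _ ->]; rewrite /root hp.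
have := max_poly_roots np hr.
by rewrite size_map size_iota ltnn map_inj_uniq // iota_uniq => /(_ isT).
Qed.

(** Facts about a real number of parts are transferred from integers by this principle: both sides
    are polynomials in [kap] that agree at all large integers. *)
Lemma ispoly_eq f g m : ispoly f -> ispoly g ->
  (forall k : nat, (m <= k)%N -> f k%:R = g k%:R) -> f =1 g.
Proof.
move=> [p hp] [q hq] e s; rewrite hp hq; congr horner; apply/eqP.
rewrite -subr_eq0; apply/eqP; apply: (@poly_eq0_infinite _ (fun k => (m + k)%:R)).
  by move=> i j /eqP; rewrite eqr_nat eqn_add2l => /eqP.
by move=> k; rewrite hornerD hornerN -hp -hq e ?leq_addr ?subrr.
Qed.

Section Jint.
Variable B : Type.
Local Notation C := (B + nat)%type.

Definition ok (m : nat) (rho : nat -> C) :=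
  forall w, if rho w is inr c then (c < m)%N else true.

Lemma ok_inl m rho v x : ok m rho -> ok m (upd rho v (inl x)).
Proof. by move=> o w; rewrite /upd; case: (w == v) => //; apply: o. Qed.

Lemma ok_inr m rho v c : ok m rho -> (c < m)%N -> ok m (upd rho v (inr c)).
Proof. by move=> o cm w; rewrite /upd; case: (w == v) => //; apply: o. Qed.

Lemma okW m n rho : (m <= n)%N -> ok m rho -> ok n rho.
Proof.
by move=> mn o w; move: (o w); case: (rho w) => // c /leq_trans; apply.
Qed.

Lemma ok_fresh m rho v : ok m rho -> ok m.+1 (upd rho v (inr m)).
Proof. by move=> o; apply: ok_inr => //; apply: okW o. Qed.

(* Integral over base points and [kap] exchangeable parts of weight [om] each,
   when the parts [0, ..., m-1] have already been met: each of these is one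
   part, and the [kap - m] remaining ones are represented by part [m].  This
   makes sense for real [kap]. *)
Fixpoint jint (pts : seq B) (wt : B -> R) (om kap : R) (V : seq nat)
    (F : nat -> (nat -> C) -> R) (m : nat) (rho : nat -> C) : R :=
  if V is v :: V' then
    \sum_(x <- pts) wt x * jint pts wt om kap V' F m (upd rho v (inl x))
    + om * (\sum_(c <- iota 0 m) jint pts wt om kap V' F m (upd rho v (inr c))
            + (kap - m%:R) * jint pts wt om kap V' F m.+1 (upd rho v (inr m)))
  else F m rho.

Lemma jint_poly pts (wt : R -> B -> R) (om kap : R -> R) V F m rho :
  (forall x, ispoly (wt^~ x)) -> ispoly om -> ispoly kap ->
  (forall m rho, ispoly (fun s => F s m rho)) ->
  ispoly (fun s => jint pts (wt s) (om s) (kap s) V (F s) m rho).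
Proof.
move=> hw ho hk hF; elim: V m rho => [//|v V IH] m rho /=.
apply: ispolyD; first by apply: ispoly_sum => x; apply: ispolyM.
apply: ispolyM => //; apply: ispolyD; first exact: ispoly_sum.
by apply: ispolyM => //; apply: ispolyD => //; apply: ispoly_const.
Qed.

Variables (pts : seq B) (wt : B -> R) (om : R).

Section Real.
Variable kap : R.
Local Notation J := (jint pts wt om kap).

Lemma eq_jint V F G m rho : ok m rho ->
  (forall n r, ok n r -> F n r = G n r) -> J V F m rho = J V G m rho.
Proof.
move=> + FG; elim: V m rho => [|v V IH] m rho o /=; first exact: FG.
congr (_ + _ * (_ + _)).
- by apply: eq_bigr => x _; rewrite IH //; apply: ok_inl.
- rewrite big_seq [RHS]big_seq; apply: eq_bigr => c.
  by rewrite mem_iota => /andP[_ cm]; apply: IH; apply: ok_inr.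
- by rewrite IH //; apply: ok_fresh.
Qed.

Lemma jint_sum (T : Type) (r : seq T) V (c : T -> R) (F : T -> nat -> (nat -> C) -> R) m rho :
  J V (fun n r' => \sum_(i <- r) c i * F i n r') m rho
  = \sum_(i <- r) c i * J V (F i) m rho.
Proof.
elim: V m rho => [//|v V IH] m rho /=.
under eq_bigr do rewrite IH.
under [X in om * (X + _)]eq_bigr do rewrite IH.
rewrite IH.
under eq_bigr do rewrite big_distrr /=.
rewrite exchange_big /= [X in om * (X + _)]exchange_big /= big_distrr /= -big_split /=.
rewrite big_distrr /= -big_split /=; apply: eq_bigr => i _.
rewrite !mulrDr !big_distrr /=; congr (_ + (_ + _)).
- by apply: eq_bigr => x _; ring.
- by apply: eq_bigr => x _; ring.
- by ring.
Qed.

(** The only factors of unclear sign are [kap - m]. Each variable meets at most one new part, so [m]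
    does not exceed [kap] at any stage. *)
Lemma jint_ge0 V F m rho : (forall x, 0 <= wt x) -> 0 <= om ->
  (m + size V)%:R <= kap -> (forall n r, 0 <= F n r) -> 0 <= J V F m rho.
Proof.
move=> hw ho + hF; elim: V m rho => [//|v V IH] m rho /= hk.
have h1 : (m + size V)%:R <= kap by apply: le_trans hk; rewrite ler_nat; lia.
have h2 : (m.+1 + size V)%:R <= kap by apply: le_trans hk; rewrite ler_nat; lia.
have h3 : m%:R <= kap by apply: le_trans h1; rewrite ler_nat; lia.
apply: addr_ge0; first by apply: sumr_ge0 => x _; apply: mulr_ge0 => //; apply: IH.
apply: mulr_ge0 => //; apply: addr_ge0; first by apply: sumr_ge0 => c _; apply: IH.
by apply: mulr_ge0; [rewrite subr_ge0 | apply: IH].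
Qed.

End Real.

Definition kms (k : nat) : seq (R * C) :=
  [seq (wt x, inl x) | x <- pts] ++ [seq (om, inr c) | c <- iota 0 k].

Lemma sum_kms k (f : C -> R) : \sum_(p <- kms k) p.1 * f p.2 =
  \sum_(x <- pts) wt x * f (inl x) + om * \sum_(c <- iota 0 k) f (inr c).
Proof. by rewrite big_cat !big_map /= -mulr_sumr. Qed.

Definition swapC (c d : nat) (z : C) : C :=
  match z with
  | inl x => inl x
  | inr e => inr (if e == c then d else if e == d then c else e)
  end.

Lemma sum_swap k c d (f : nat -> R) : (c < k)%N -> (d < k)%N ->
  \sum_(e <- iota 0 k) f (if e == c then d else if e == d then c else e)
  = \sum_(e <- iota 0 k) f e.
Proof.
move=> ck dk.
pose s e := if e == c then d else if e == d then c else e.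
have sK : involutive s.
  by move=> e; rewrite /s; do !case: eqP => //; lia.
rewrite -(big_map s xpredT f); apply: perm_big; apply: uniq_perm.
- by rewrite map_inj_uniq ?iota_uniq //; apply: inv_inj.
- exact: iota_uniq.
move=> e; rewrite -{1}[e]sK mem_map; last exact: inv_inj.
by rewrite !mem_iota /s; do !case: eqP => //; lia.
Qed.

(** The [k - m] parts not yet met contribute equally, since a transposition moves part [m] to any of
    them without affecting [G]. Weighting part [m] by [k - m] thus gives the full sum. *)
Lemma jint_nat k V F G m rho : (m <= k)%N -> ok m rho ->
  (forall n r, (n <= k)%N -> ok n r -> F n r = G r) ->
  (forall c d r, (c < k)%N -> (d < k)%N -> G (swapC c d \o r) = G r) ->
  jint pts wt om k%:R V F m rho = integ (kms k) V G rho.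
Proof.
move=> + + hF hG; elim: V m rho => [|v V IH] m rho mk o /=; first exact: hF.
rewrite (sum_kms _ (fun z => integ (kms k) V G (upd rho v z))); congr (_ + _ * _).
  by apply: eq_bigr => x _; rewrite IH //; apply: ok_inl.
have -> : iota 0 k = iota 0 m ++ iota m (k - m).
  by rewrite -{2}[m]add0n -iotaD subnKC.
rewrite big_cat /=; congr (_ + _).
  rewrite big_seq [RHS]big_seq; apply: eq_bigr => c.
  by rewrite mem_iota => /andP[_ cm]; apply: IH => //; apply: ok_inr.
(* If all parts are already met, the induction hypothesis does not apply to [m.+1], but the
   coefficient of that term vanishes. *)
have [->|ltmk] := eqVneq m k; first by rewrite subrr subnn mul0r big_nil.
have {}ltmk : (m < k)%N by rewrite ltn_neqAle ltmk.
rewrite (IH m.+1) //; last exact: ok_fresh.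
transitivity (\sum_(c <- iota m (k - m)) integ (kms k) V G (upd rho v (inr m))).
  by rewrite big_const_seq count_predT size_iota iter_addr_0 -natrB // mulr_natl.
rewrite big_seq [RHS]big_seq; apply: eq_bigr => c.
rewrite mem_iota subnKC // => /andP[mc ck].
(* Swapping [m] and [c] fixes [rho], whose parts are all below [m]. *)
rewrite -(@integ_shift _ _ (swapC m c)); last by move=> r; apply: hG.
  congr integ; apply: functional_extensionality => w; rewrite /upd /=.
  case: (w == v) => /=; first by rewrite eqxx.
  move: (o w); case: (rho w) => //= d dm.
  by congr inr; do 2?case: eqP => //; lia.
move=> f; rewrite (sum_kms _ (f \o swapC m c)) sum_kms; congr (_ + _ * _).
exact: (sum_swap (f \o inr)).
Qed.

End Jint.

(** * Densities in the interpolated model *)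

(** Disjoint union of the graph [r] on the base points and a complete multipartite graph, each
    natural number standing for one part. *)
Definition adjC (B : Type) (r : B -> B -> bool) (z z' : B + nat) : bool :=
  match z, z' with
  | inl x, inl y => r x y
  | inr c, inr d => c != d
  | _, _ => false
  end.

Lemma adjC_sym B (r : B -> B -> bool) : symmetric r -> symmetric (adjC r).
Proof. by move=> sr [x|c] [y|d] //=; rewrite eq_sym. Qed.

Lemma adjC_swap B (r : B -> B -> bool) c d z z' :
  adjC r (swapC c d z) (swapC c d z') = adjC r z z'.
Proof. by case: z z' => [x|e] [y|f] //=; do !case: eqP => //; lia. Qed.

Lemma homind_swap B (r : B -> B -> bool) E c d rho :
  homind (adjC r) E (swapC c d \o rho) = homind (adjC r) E rho.
Proof.
by congr (nat_of_bool _)%:R; apply: eq_all => e; rewrite /= adjC_swap.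
Qed.

Definition jdens B (r : B -> B -> bool) (x0 : B) pts wt om kap (H : pgraph) : R :=
  jint pts wt om kap (Vs H) (fun=> homind (adjC r) (Es H)) 0 (fun=> inl x0).

Definition jldens B (r : B -> B -> bool) (x0 : B) pts wt om kap (H : pgraph)
    (m : nat) (psi : nat -> B + nat) : R :=
  jint pts wt om kap (unlabeled H) (fun=> homind (adjC r) (Es H)) m
    (lasg (inl x0) H psi).

Definition jev B (r : B -> B -> bool) (x0 : B) pts wt om kap (f : fsum) : R :=
  \sum_(p <- f) p.1 * jdens r x0 pts wt om kap p.2.

Definition jlev B (r : B -> B -> bool) (x0 : B) pts wt om kap (f : fsum)
    (m : nat) (psi : nat -> B + nat) : R :=
  \sum_(p <- f) p.1 * jldens r x0 pts wt om kap p.2 m psi.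

Lemma jdens_poly B (r : B -> B -> bool) x0 pts (wt : R -> B -> R) om kap H :
  (forall x, ispoly (wt^~ x)) -> ispoly om -> ispoly kap ->
  ispoly (fun s => jdens r x0 pts (wt s) (om s) (kap s) H).
Proof.
by move=> hw ho hk; apply: jint_poly => // m rho; apply: ispoly_const.
Qed.

Lemma jldens_poly B (r : B -> B -> bool) x0 pts (wt : R -> B -> R) om kap H m psi :
  (forall x, ispoly (wt^~ x)) -> ispoly om -> ispoly kap ->
  ispoly (fun s => jldens r x0 pts (wt s) (om s) (kap s) H m psi).
Proof.
by move=> hw ho hk; apply: jint_poly => // n rho; apply: ispoly_const.
Qed.

Lemma jev_poly B (r : B -> B -> bool) x0 pts (wt : R -> B -> R) om kap f :
  (forall x, ispoly (wt^~ x)) -> ispoly om -> ispoly kap ->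
  ispoly (fun s => jev r x0 pts (wt s) (om s) (kap s) f).
Proof.
move=> hw ho hk; apply: ispoly_sum => p; apply: ispolyM; first exact: ispoly_const.
exact: jdens_poly.
Qed.

Section Interpolation.
Variables (B : Type) (r : B -> B -> bool) (x0 : B).
Variables (pts : seq B) (wt : B -> R) (om : R).
Hypothesis sym_r : symmetric r.
Local Notation C := (B + nat)%type.
Local Notation c0 := (inl x0 : C).
Local Notation A := (adjC r).
Local Notation JD := (jdens r x0 pts wt om).
Local Notation JL := (jldens r x0 pts wt om).
Local Notation ms := (kms pts wt om).

Let cpoly (c : R) : ispoly (fun=> c). Proof. exact: ispoly_const. Qed.

Lemma jldens_kap H m psi : ispoly (fun s => JL s H m psi).
Proof. exact: (@jldens_poly _ r x0 pts (fun=> wt) (fun=> om) id _ _ _ _ _ ispoly_id). Qed.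

Lemma jdens_kap H : ispoly (fun s => JD s H).
Proof. exact: (@jdens_poly _ r x0 pts (fun=> wt) (fun=> om) id _ _ _ ispoly_id). Qed.

Lemma ok0 : ok 0 (fun=> c0). Proof. by []. Qed.

Lemma ok_lasg H m psi : ok m psi -> ok m (lasg c0 H psi).
Proof. by move=> o w; rewrite /lasg; case: (getlab H w) => // a; apply: o. Qed.

Lemma jdens_nat k H : JD k%:R H = dens (ms k) A c0 H.
Proof. by apply: jint_nat => // c d s _ _; apply: homind_swap. Qed.

Lemma jldens_nat k H m psi : (m <= k)%N -> ok m psi ->
  JL k%:R H m psi = ldens (ms k) A c0 H psi.
Proof.
move=> mk o; apply: jint_nat => //; first exact: ok_lasg.
by move=> c d s _ _; apply: homind_swap.
Qed.

Lemma ldens_swap k H c d psi : (c < k)%N -> (d < k)%N ->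
  ldens (ms k) A c0 H (swapC c d \o psi) = ldens (ms k) A c0 H psi.
Proof.
move=> ck dk; rewrite /ldens -[RHS](@integ_shift _ _ (swapC c d)).
- by congr integ; apply: functional_extensionality => v; rewrite /lasg /=; case: (getlab H v).
- move=> f; rewrite (sum_kms _ _ _ _ (f \o swapC c d)) sum_kms; congr (_ + _ * _).
  exact: (sum_swap (f \o inr)).
- by move=> s; apply: homind_swap.
Qed.

Lemma jldens_pprod kap H1 H2 m psi : wf H1 -> wf H2 -> ok m psi ->
  JL kap (pprod H1 H2) m psi = JL kap H1 m psi * JL kap H2 m psi.
Proof.
move=> wf1 wf2 o.
apply: (@ispoly_eq (fun s => JL s _ _ _) (fun s => JL s _ _ _ * JL s _ _ _) m).
- exact: jldens_kap.
- by apply: ispolyM; exact: jldens_kap.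
- by move=> k mk; rewrite !jldens_nat // ldens_pprod.
Qed.

(** For fixed weights the mass cannot in general be 1 at all integers, so the interpolation carries
    its power along; the mass is normalized only afterwards. *)
Lemma jint_jldens_mass kap H Ls : wf H -> uniq Ls -> {subset labs H <= Ls} ->
  jint pts wt om kap Ls (JL kap H) 0 (fun=> c0)
  = (\sum_(x <- pts) wt x + om * kap) ^+ (size Ls - size (labs H)) * JD kap H.
Proof.
move=> wfH uL sL.
apply: (@ispoly_eq (fun s => jint pts wt om s Ls (JL s H) 0 _)
  (fun s => (\sum_(x <- pts) wt x + om * s) ^+ _ * JD s H) 0).
- apply: (@jint_poly _ pts (fun=> wt) (fun=> om) id _ (fun s => JL s H)) => //; first exact: ispoly_id.
  move=> m rho.
  exact: jldens_kap.
- apply: ispolyM; last exact: jdens_kap.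
  by apply/ispolyX/ispolyD => //; apply: ispolyM => //; exact: ispoly_id.
move=> k _; rewrite (@jint_nat _ _ _ _ k Ls _ (ldens (ms k) A c0 H)) //; last 2 first.
- by move=> m s mk o; apply: jldens_nat.
- by move=> c d s ck dk; apply: ldens_swap.
rewrite integ_ldens // jdens_nat; congr (_ ^+ _ * _).
have := sum_kms pts wt om k (fun=> 1).
rewrite big_const_seq count_predT size_iota iter_addr_0.
by under eq_bigr do rewrite mulr1; under [X in _ = X + _]eq_bigr do rewrite mulr1.
Qed.

Lemma jdens_iso kap H H' : wf H -> wf H' -> pl_iso H H' -> JD kap H = JD kap H'.
Proof.
move=> wfH wfH' iso; apply: (@ispoly_eq (fun s => JD s H) (fun s => JD s H') 0).
- exact: jdens_kap.
- exact: jdens_kap.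
- by move=> k _; rewrite !jdens_nat; apply: dens_iso => //; apply: adjC_sym.
Qed.

Variable kap : R.

Lemma jldens_nolab H : Ls H = [::] -> JL kap H 0 (fun=> c0) = JD kap H.
Proof.
move=> e; rewrite /jldens /jdens /unlabeled.
have g v : getlab H v = None by rewrite /getlab e.
rewrite (eq_filter (a2 := predT)) ?filter_predT; last by move=> v; rewrite g.
by congr jint; apply: functional_extensionality => v; rewrite /lasg g.
Qed.

Lemma jdens_pprod H1 H2 : wf H1 -> wf H2 -> Ls H1 = [::] -> Ls H2 = [::] ->
  JD kap (pprod H1 H2) = JD kap H1 * JD kap H2.
Proof.
move=> wf1 wf2 l1 l2; by rewrite -!jldens_nolab ?jldens_pprod ?Ls_pprod0.
Qed.

Lemma jlev_cat f g m psi :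
  jlev r x0 pts wt om kap (f ++ g) m psi
  = jlev r x0 pts wt om kap f m psi + jlev r x0 pts wt om kap g m psi.
Proof. exact: big_cat. Qed.

Lemma jlev_fmul f g m psi : inF f -> inF g -> ok m psi ->
  jlev r x0 pts wt om kap (fmul f g) m psi
  = jlev r x0 pts wt om kap f m psi * jlev r x0 pts wt om kap g m psi.
Proof.
move=> /allP wff /allP wfg o; rewrite /jlev big_allpairs_dep big_distrl /=.
rewrite big_seq [RHS]big_seq; apply: eq_bigr => p /wff wp.
rewrite big_distrr /= big_seq [RHS]big_seq; apply: eq_bigr => q /wfg wq.
rewrite /= jldens_pprod //.
rewrite RmultE; ring.
Qed.

Hypothesis mass1 : \sum_(x <- pts) wt x + om * kap = 1.

Lemma jint_jldens H Ls : wf H -> uniq Ls -> {subset labs H <= Ls} ->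
  jint pts wt om kap Ls (JL kap H) 0 (fun=> c0) = JD kap H.
Proof. by move=> *; rewrite jint_jldens_mass // mass1 expr1n mul1r. Qed.

Lemma jldens_one F m psi : wf F -> size (Vs F) = 1%N -> JL kap F m psi = 1.
Proof.
move=> wfF; rewrite /jldens.
have E0 : size (Vs F) = 1%N -> Es F = [::].
  case e: (Vs F) => [|v [|]] // _; case/and5P: wfF => _ + _ _ _.
  case: (Es F) => // f E /= /andP[/and3P[]]; rewrite e !inE => /eqP-> /eqP->.
  by rewrite eqxx.
move=> s1; rewrite E0 // /unlabeled.
case: (Vs F) s1 => [|v [|]] //= _; case: (_ == _) => //=.
rewrite -[RHS]mass1 -!big_distrl /= mulr1 big_const_seq count_predT size_iota iter_addr_0.
by rewrite /homind /= ; congr (_ + _); ring.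
Qed.

(** [F] may share its label with a vertex of [H], so the comparison is made for labeled densities,
    where the product is multiplicative and [F] contributes the factor 1; then one averages over all
    labels. *)
Lemma jdens_GK F H : wf F -> wf H -> size (Vs F) = 1%N ->
  JD kap (pprod F H) = JD kap H.
Proof.
move=> wfF wfH s1; set Ls := undup (labs F ++ labs H).
have uL : uniq Ls by apply: undup_uniq.
rewrite -(@jint_jldens _ Ls) ?wf_pprod //; last first.
  by move=> a /labs_pprod; rewrite mem_undup.
rewrite -(@jint_jldens H Ls) //; last by move=> a i; rewrite mem_undup mem_cat i orbT.
apply: eq_jint; first exact: ok0.
by move=> n s o; rewrite jldens_pprod // jldens_one // mul1r.
Qed.

Lemma jev_funlabel f Ls : inF f -> uniq Ls ->
  (forall p, p \in f -> {subset labs p.2 <= Ls}) ->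
  jev r x0 pts wt om kap (funlabel f)
  = jint pts wt om kap Ls (jlev r x0 pts wt om kap f) 0 (fun=> c0).
Proof.
move=> /allP wff uL sL; rewrite /jev big_map jint_sum.
rewrite big_seq [RHS]big_seq; apply: eq_bigr => p pf.
by rewrite jint_jldens //; [apply: wff | apply: sL].
Qed.

End Interpolation.

(** * Evaluation of the quotient algebra and of sums of squares *)

Lemma coef_cat f g H : coef (f ++ g) H = coef f H + coef g H.
Proof.
elim: f => [|p f IH]; first by rewrite add0r.
by rewrite /= -/(coef _ _) IH !RplusE addrA.
Qed.

Lemma sum_coef (E : pgraph -> R) f S : uniq S -> {subset map snd f <= S} ->
  \sum_(p <- f) p.1 * E p.2 = \sum_(H <- S) coef f H * E H.
Proof.
move=> uS; elim: f => [|p f IH] sS.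
  by rewrite big_nil big1 // => H _; rewrite mul0r.
rewrite big_cons IH; last by move=> H i; apply: sS; rewrite inE i orbT.
transitivity (\sum_(H <- S) ((if p.2 == H then p.1 else 0) * E H + coef f H * E H)).
  rewrite big_split /=; congr (_ + _); rewrite (bigD1_seq p.2) //=; last first.
    by apply: sS; rewrite mem_head.
  rewrite eqxx big1 ?addr0 // => H; rewrite eq_sym => /negbTE ->.
  by rewrite mul0r.
by apply: eq_bigr => H _; rewrite -mulrDl.
Qed.

Lemma eqA_sound (E : pgraph -> R) f g :
  (forall c, gen_ok c -> \sum_(p <- gen_vec c) p.1 * E p.2 = 0) ->
  eqA f g -> \sum_(p <- f) p.1 * E p.2 = \sum_(p <- g) p.1 * E p.2.
Proof.
move=> hE [cs [okcs e]].
pose S := undup (map snd f ++ map snd g ++ flatten [seq map snd (gen_vec c.2) | c <- cs]).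
have uS : uniq S by apply: undup_uniq.
rewrite (sum_coef _ uS) => [|H i]; last by rewrite mem_undup mem_cat i.
rewrite (sum_coef _ uS) => [|H i]; last by rewrite mem_undup !mem_cat i orbT.
apply/eqP; rewrite -subr_eq0 -sumrB; apply/eqP.
under eq_bigr => H _ do rewrite -mulrBl -[coef f H - coef g H]/(Rminus (coef f H) (coef g H)) e.
have : {subset flatten [seq map snd (gen_vec c.2) | c <- cs] <= S}.
  by move=> H i; rewrite mem_undup !mem_cat i !orbT.
clearbody S; elim: cs okcs {e} => [|c cs IH] okcs sS.
  by rewrite big1 // => H _; rewrite mul0r.
inversion okcs; subst.
transitivity (\sum_(H <- S) (c.1 * (coef (gen_vec c.2) H * E H) +
  foldr (fun c0 acc => Rplus (Rmult c0.1 (coef (gen_vec c0.2) H)) acc) 0 cs * E H)).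
  by apply: eq_bigr => H _; rewrite /= RplusE RmultE; ring.
rewrite big_split /= -mulr_sumr -(sum_coef _ uS) => [|H i]; last first.
  by apply: sS; rewrite /= mem_cat i.
rewrite hE // mulr0 add0r; apply: IH => // H i.
by apply: sS; rewrite /= mem_cat i orbT.
Qed.

Lemma sum_pair (E : pgraph -> R) H H' :
  \sum_(p <- [:: (R1, H); (Ropp R1, H')]) p.1 * E p.2 = E H - E H'.
Proof. by rewrite !big_cons big_nil /= mul1r mulN1r addr0. Qed.

Section Model.
Variables (B : Type) (r : B -> B -> bool) (x0 : B).
Variables (pts : seq B) (wt : B -> R) (om kap : R).
Hypothesis sym_r : symmetric r.
Hypothesis mass1 : \sum_(x <- pts) wt x + om * kap = 1.
Local Notation EV := (jev r x0 pts wt om kap).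

Lemma jev_eqA f g : eqA f g -> EV f = EV g.
Proof.
apply: eqA_sound => -[H H'|F H] /= [h1 [h2 h3]].
  by rewrite sum_pair (jdens_iso _ _ _ _ sym_r _ h1 h2 h3) subrr.
by rewrite sum_pair jdens_GK // subrr.
Qed.

Lemma jev_cat f g : EV (f ++ g) = EV f + EV g.
Proof. exact: big_cat. Qed.

Lemma jev_fmul f g : inF0 f -> inF0 g -> EV (fmul f g) = EV f * EV g.
Proof.
move=> /allP wff /allP wfg; rewrite /jev big_allpairs_dep big_distrl /=.
rewrite big_seq [RHS]big_seq; apply: eq_bigr => p /wff/andP[wp /eqP lp].
rewrite big_distrr /= big_seq [RHS]big_seq; apply: eq_bigr => q /wfg/andP[wq /eqP lq].
by rewrite /= jdens_pprod // RmultE; ring.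
Qed.

Lemma inF_fmul f g : inF f -> inF g -> inF (fmul f g).
Proof.
move=> /allP wff /allP wfg; apply/allP => _ /allpairsP[[p q] /= [/wff hp /wfg hq ->]].
exact: wf_pprod.
Qed.

Definition fsum_labs (f : fsum) : seq nat := flatten [seq labs p.2 | p <- f].
Definition sos_labs (gs : seq fsum) : seq nat :=
  undup (flatten [seq fsum_labs g | g <- gs]).

Hypothesis wt_ge0 : forall x, 0 <= wt x.
Hypothesis om_ge0 : 0 <= om.

(** Removing labels means averaging over their positions, and by multiplicativity the integrand is a
    sum of squares. Having at least as many parts as labels keeps the weights of this average
    nonnegative. *)
Lemma jev_sos_ge0 gs : all inF gs -> (size (sos_labs gs))%:R <= kap ->
  0 <= EV (funlabel (sumsq gs)).
Proof.
move=> /allP wfgs hk; rewrite (@jev_funlabel _ _ _ _ _ _ _ mass1 _ (sos_labs gs)).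
- rewrite (@eq_jint _ _ _ _ _ _ _ (fun m psi => \sum_(g <- gs)
      jlev r x0 pts wt om kap g m psi ^+ 2)) //; last first.
    move=> m psi o; rewrite {1}/jlev big_flatten big_map big_seq [RHS]big_seq.
    apply: eq_bigr => g /wfgs wg; rewrite -[LHS]/(jlev _ _ _ _ _ _ _ _ _).
    by rewrite jlev_fmul // expr2.
  by apply: jint_ge0 => // m psi; apply: sumr_ge0 => g _; apply: sqr_ge0.
- apply/allP => p /flattenP[_ /mapP[g /wfgs wg ->]].
  by move: p; apply/allP; apply: inF_fmul.
- exact: undup_uniq.
move=> p /flattenP[_ /mapP[g gi ->]] /allpairsP[[p1 p2] /= [i1 i2 ->]] a /labs_pprod.
rewrite mem_undup mem_cat => ha; apply/flattenP; exists (fsum_labs g); first exact: map_f.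
by case/orP: ha => ha; apply/flattenP; [exists (labs p1.2) | exists (labs p2.2)] => //;
   apply/mapP; [exists p1 | exists p2].
Qed.

End Model.

(** * The chord inequality for triangle densities *)

(* Equality holds for [K] or [K+1] equal weights.  The minorants of each
   summand are the affine functions tangent at [1/(K+1)] and at [1/K]; the
   former is a minorant only for [z i >= 1/(K(K+1))], the latter gives a
   nonnegative total only if at most [K] of the [z i] are that large. *)
Lemma sum_cubic_ge0 (F : realFieldType) (I : finType) (z : I -> F) (K : nat) :
  (2 <= K)%N -> (forall i, 0 <= z i) -> \sum_i z i = 1 ->
  0 <= \sum_i z i * (1 - K%:R * z i) * (1 - K.+1%:R * z i).
Proof.
move=> K2 z0 z1; set k : F := K%:R.
have -> : K.+1%:R = k + 1 by rewrite -natr1.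
have k2 : 2 <= k by rewrite /k ler_nat.
pose big i := 1 <= k * (k + 1) * z i.
set m := #|[pred i | big i]|.
have zsplit : \sum_(i | big i) z i + \sum_(i | ~~ big i) z i = 1.
  by rewrite -[RHS]z1 [RHS](bigID big).
have eta0 : 0 <= \sum_(i | ~~ big i) z i by apply: sumr_ge0.
have sm i : ~~ big i -> k * z i * (k + 1) <= 1.
  by rewrite /big -ltNge => h; rewrite mulrAC ltW.
have sumc (c d : F) : \sum_(i | big i) (c + d * z i)
    = m%:R * c + d * \sum_(i | big i) z i.
  by rewrite big_split /= sumr_const mulr_natl mulr_sumr.
have [hm|hm] := ltnP K m.
  suff : 0 <= (k + 1) ^+ 2 * \sum_i z i * (1 - k * z i) * (1 - (k + 1) * z i).
    by rewrite pmulr_rge0 // exprn_gt0 //; lra.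
  rewrite mulr_sumr (bigID big) /=; apply: addr_ge0; last first.
    apply: sumr_ge0 => i /sm h; apply: mulr_ge0; first exact: sqr_ge0.
    have kz : 0 <= k * z i by apply: mulr_ge0 => //; lra.
    apply: mulr_ge0; first apply: mulr_ge0 => //; nra.
  apply: (@le_trans _ _ (\sum_(i | big i) (1 + (- (k + 1)) * z i))).
    rewrite sumc mulr1 mulNr subr_ge0.
    have : k + 1 <= m%:R by rewrite natr1 ler_nat.
    nra.
  apply: ler_sum => i hi; rewrite -subr_ge0.
  have -> : (k + 1) ^+ 2 * (z i * (1 - k * z i) * (1 - (k + 1) * z i)) - (1 + - (k + 1) * z i)
     = (1 - (k + 1) * z i) ^+ 2 * (k * (k + 1) * z i - 1) by ring.
  by apply: mulr_ge0; [exact: sqr_ge0 | rewrite subr_ge0].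
have hmk : m%:R <= k by rewrite ler_nat.
suff : 0 <= k ^+ 2 * \sum_i z i * (1 - k * z i) * (1 - (k + 1) * z i).
  by rewrite pmulr_rge0 // exprn_gt0 //; lra.
rewrite mulr_sumr (bigID big) /=.
have tangent i : k ^+ 2 * (z i * (1 - k * z i) * (1 - (k + 1) * z i))
  = - 1 + k * z i + (1 - k * z i) ^+ 2 * (k * (k + 1) * z i + 1) by ring.
have kz i : 0 <= k * (k + 1) * z i by apply: mulr_ge0 => //; nra.
move: K2; rewrite leq_eqVlt => /orP[/eqP K2|K3]; last first.
  have k3 : 3 <= k by rewrite /k ler_nat.
  have hb : m%:R * -1 + k * \sum_(i | big i) z i <=
      \sum_(i | big i) k ^+ 2 * (z i * (1 - k * z i) * (1 - (k + 1) * z i)).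
    rewrite -sumc; apply: ler_sum => i _; rewrite tangent lerDl.
    by apply: mulr_ge0; [exact: sqr_ge0 | move: (kz i); lra].
  have hs : k * \sum_(i | ~~ big i) z i <=
      \sum_(i | ~~ big i) k ^+ 2 * (z i * (1 - k * z i) * (1 - (k + 1) * z i)).
    rewrite mulr_sumr; apply: ler_sum => i /sm h.
    have : 1 <= k * (1 - k * z i) * (1 - (k + 1) * z i).
      set y := k * z i in h *; have y0 : 0 <= y by apply: mulr_ge0 => //; lra.
      have -> : k * (1 - y) * (1 - (k + 1) * z i) = (1 - y) * (k - y * (k + 1)).
        by rewrite /y; ring.
      have hy : y * 4 <= 1 by nra.
      nra.
    have -> : k ^+ 2 * (z i * (1 - k * z i) * (1 - (k + 1) * z i))
      = k * z i * (k * (1 - k * z i) * (1 - (k + 1) * z i)) by ring.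
    by move=> P; rewrite ler_peMr // mulr_ge0 //; lra.
  have : k * \sum_(i | big i) z i + k * \sum_(i | ~~ big i) z i = k by rewrite -mulrDr zsplit mulr1.
  lra.
(* For [K = 2] the bound used for small entries fails: at [z = 1/6] the factor
   [2 (1 - 2 z) (1 - 3 z)] is only [2/3]. The loss is controlled by the total [eta] of the small
   entries. *)
have ek : k = 2 by rewrite /k -K2.
set eta := \sum_(i | ~~ big i) z i in zsplit eta0 *.
have zeta i : ~~ big i -> z i <= eta.
  by move=> hi; rewrite /eta (bigD1 i) //= lerDl; apply: sumr_ge0.
have rho : \sum_(i | big i) z i = 1 - eta by lra.
have zbig i : big i -> 2 <= 6 * z i + 1 by rewrite /big ek; lra.
have zsm i : ~~ big i -> 6 * z i <= 1 by move=> /sm; rewrite ek; lra.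
have [m2|m1] := eqVneq m 2%N.
  (* Since [6 z + 1 >= 2], the last term of [tangent] is at least [2 (1 - 2 z)^2], which is replaced
     by its tangent at [1 - 2 z = eta], the mean over the two big entries. These minorants add up to
     [4 eta^2 - 2 eta], which [hs] cancels exactly. *)
  have hb : \sum_(i | big i) (-1 + 4 * eta - 2 * eta ^+ 2 + (2 - 8 * eta) * z i) <=
      \sum_(i | big i) k ^+ 2 * (z i * (1 - k * z i) * (1 - (k + 1) * z i)).
    apply: ler_sum => i /zbig h; rewrite tangent ek.
    have h1 : 0 <= (1 - 2 * z i) ^+ 2 * ((6 * z i + 1) - 2).
      by apply: mulr_ge0; [exact: sqr_ge0 | lra].
    have := sqr_ge0 (1 - 2 * z i - eta); nra.
  have hs : (2 - 4 * eta) * eta <=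
      \sum_(i | ~~ big i) k ^+ 2 * (z i * (1 - k * z i) * (1 - (k + 1) * z i)).
    rewrite {2}/eta mulr_sumr; apply: ler_sum => i hi; rewrite ek.
    have h1 := zeta i hi; have h2 := zsm i hi; have h3 := z0 i.
    suff : 0 <= z i * (4 * (1 - 5 * z i + 6 * z i ^+ 2) - 2 + 4 * eta) by nra.
    apply: mulr_ge0 => //; nra.
  move: hb; rewrite sumc rho m2; nra.
have {}m1 : m%:R <= 1 :> F by rewrite lern1; move: hm m1; rewrite -K2; lia.
have hb : m%:R * -1 + k * \sum_(i | big i) z i <=
    \sum_(i | big i) k ^+ 2 * (z i * (1 - k * z i) * (1 - (k + 1) * z i)).
  rewrite -sumc; apply: ler_sum => i _; rewrite tangent lerDl.
  by apply: mulr_ge0; [exact: sqr_ge0 | move: (kz i); lra].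
(* The constant [4/3] is the value of [4 (1 - 2 z) (1 - 3 z)] at the threshold [z = 1/6]. *)
have hs : (4 / 3) * eta <=
    \sum_(i | ~~ big i) k ^+ 2 * (z i * (1 - k * z i) * (1 - (k + 1) * z i)).
  rewrite /eta mulr_sumr; apply: ler_sum => i /zsm h; rewrite ek.
  have h3 := z0 i.
  suff : 0 <= z i * (4 * (1 - 5 * z i + 6 * z i ^+ 2) - 4 / 3) by lra.
  apply: mulr_ge0 => //; nra.
have eta1 : eta <= 1.
  have : 0 <= \sum_(i | big i) z i by apply: sumr_ge0.
  lra.
move: hb hs; rewrite rho ek; lra.
Qed.

Lemma sum_neq (F : ringType) (I : finType) (f : I -> F) c :
  \sum_l f l * (c != l)%:R = \sum_l f l - f c.
Proof.
rewrite [X in _ = X - _](bigD1 c) //= (bigD1 c) //= eqxx mulr0 add0r addrAC subrr add0r.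
by apply: eq_bigr => l; rewrite eq_sym => ->; rewrite mulr1.
Qed.

Section Chord.
Variables (F : realFieldType) (I : finType) (A : rel I).
Hypotheses (symA : symmetric A) (irrA : irreflexive A).
Implicit Types (w r : I -> F) (G : I -> I -> F).

Definition wsum w : F := \sum_i w i.
Definition wquad G w : F := \sum_i w i * \sum_j w j * G i j.
Definition wedge w : F := wquad (fun i j => (A i j)%:R) w.
Definition Gtri i j l : F := (A i j)%:R * (A j l)%:R * (A i l)%:R.
Definition wtri w : F := \sum_i w i * wquad (Gtri i) w.

Section TwoPoints.
Variables (i j : I) (r : I -> F).
Hypotheses (nij : i != j) (ri : r i = 0) (rj : r j = 0).

Definition two_pt (x y : F) : I -> F :=
  fun l => if l == i then x else if l == j then y else r l.

Lemma sum_two_pt x y (f : I -> F) :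
  \sum_l two_pt x y l * f l = \sum_l r l * f l + x * f i + y * f j.
Proof.
rewrite (bigD1 i) //= (bigD1 j) 1?eq_sym //= /two_pt eqxx eq_sym (negbTE nij) eqxx.
rewrite [X in _ = X + _ + _](bigD1 i) //= [X in _ = _ + X + _ + _](bigD1 j) 1?eq_sym //= ri rj.
rewrite (eq_bigr (fun l => r l * f l)) => [|l /andP[/negbTE-> /negbTE->] //].
ring.
Qed.

Lemma wquad_two_pt x y G : (forall a b, G a b = G b a) ->
  G i i = 0 -> G j j = 0 -> G i j = 0 ->
  wquad G (two_pt x y) = wquad G r + 2 * x * (\sum_l r l * G i l)
                         + 2 * y * (\sum_l r l * G j l).
Proof.
move=> sG Gii Gjj Gij; rewrite /wquad.
under eq_bigr do rewrite sum_two_pt.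
rewrite sum_two_pt Gii Gjj Gij (sG j i) Gij.
under eq_bigr do rewrite !mulrDr.
rewrite !big_split /=.
have h z c : \sum_l r l * (z * G l c) = z * \sum_l r l * G c l.
  by rewrite mulr_sumr; apply: eq_bigr => l _; rewrite (sG l c); ring.
rewrite !h; ring.
Qed.

Hypothesis Aij : ~~ A i j.

Lemma Gtri_sym a b c : Gtri a b c = Gtri a c b.
Proof. by rewrite /Gtri (symA b c); ring. Qed.

(** No triangle contains both [i] and [j], as they are not adjacent, and none contains a vertex
    twice, so the weights enter linearly. The factor 3 counts the positions of the vertex in an
    ordered triangle. *)
Lemma wtri_two_pt x y : wtri (two_pt x y) = wtri r
  + 3 * x * wquad (Gtri i) r + 3 * y * wquad (Gtri j) r.
Proof.
have Aji : A j i = false by rewrite symA (negbTE Aij).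
have q l : wquad (Gtri l) (two_pt x y) = wquad (Gtri l) r
    + 2 * x * (\sum_b r b * Gtri l i b) + 2 * y * (\sum_b r b * Gtri l j b).
  apply: wquad_two_pt; first exact: Gtri_sym.
  - by rewrite /Gtri irrA /= mulr0n; ring.
  - by rewrite /Gtri irrA /= mulr0n; ring.
  - by rewrite /Gtri (negbTE Aij) /= mulr0n; ring.
rewrite /wtri; under eq_bigr do rewrite q.
rewrite sum_two_pt.
have h c : \sum_l r l * (\sum_b r b * Gtri l c b) = wquad (Gtri c) r.
  apply: eq_bigr => l _; congr (_ * _); apply: eq_bigr => b _.
  by rewrite /Gtri (symA l c) (symA l b); congr (_ * _); rewrite (symA b l); ring.
have zero c d b : ~~ A c d -> Gtri c d b = 0.
  by move=> /negbTE h'; rewrite /Gtri h' /= mulr0n; ring.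
have zs c d : ~~ A c d -> \sum_b r b * Gtri c d b = 0.
  by move=> h'; rewrite big1 // => b _; rewrite zero // mulr0.
rewrite !zs ?irrA ?Aji ?(negbTE Aij) //.
under eq_bigr do rewrite !mulrDr.
rewrite !big_split /=.
have h' z c : \sum_l r l * (2 * z * \sum_b r b * Gtri l c b) = 2 * z * wquad (Gtri c) r.
  by rewrite -h mulr_sumr; apply: eq_bigr => l _; ring.
rewrite !h'; ring.
Qed.

End TwoPoints.

Variable K : nat.
Hypothesis K_gt0 : (0 < K)%N.
Let k : F := K%:R.

(** Vanishes at the balanced complete [K]-partite and [(K+1)]-partite graphs: this is the
    homogeneous form of the chord joining two consecutive Turan points in the plane of edge and
    triangle densities. *)
Definition chord w : F :=
  k * (k + 1) * wtri w - (3 * k + 2) * (k - 1) * wsum w * wedge w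
  + 2 * k * (k - 1) * wsum w ^+ 3.

(** While [x + y] is fixed, the total weight is constant and the edge and triangle weights are
    affine in [x]. The interpolation between the two extremes is multiplied by [x + y] to avoid a
    division. *)
Lemma chord_two_pt i j r x y : i != j -> r i = 0 -> r j = 0 -> ~~ A i j ->
  (x + y) * chord (two_pt i j r x y)
  = x * chord (two_pt i j r (x + y) 0) + y * chord (two_pt i j r 0 (x + y)).
Proof.
move=> nij ri rj Aij; rewrite /chord !(wtri_two_pt nij) //.
have E a b : wedge (two_pt i j r a b) = wedge r + 2 * a * (\sum_l r l * (A i l)%:R)
    + 2 * b * (\sum_l r l * (A j l)%:R).
  by apply: wquad_two_pt; rewrite ?irrA ?(negbTE Aij) // => c d; rewrite symA.
have S a b : wsum (two_pt i j r a b) = wsum r + a + b.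
  have := sum_two_pt nij ri rj a b (fun=> 1).
  by rewrite !mulr1 /wsum; under eq_bigr do rewrite mulr1; under [X in _ = X + _ + _]eq_bigr do rewrite mulr1.
rewrite !E !S; ring.
Qed.

(** On a weight supported by a clique, edge and triangle weights are polynomials in the power sums,
    and the chord becomes twice a sum of cubics. After division by the total weight, [sum_cubic_ge0]
    applies. *)
Lemma chord_clique w : (forall l, 0 <= w l) ->
  (forall a b, a != b -> ~~ A a b -> w a * w b = 0) -> 0 <= chord w.
Proof.
move=> w0 cl; have wA a b : w a * w b * (A a b)%:R = w a * w b * (a != b)%:R.
  have [->|nab] := eqVneq a b; first by rewrite irrA.
  by case: (boolP (A a b)) => // /(cl _ _ nab) ->; rewrite !mul0r.
set a := wsum w; set p2 := \sum_i w i ^+ 2; set p3 := \sum_i w i ^+ 3.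
have aE : \sum_i w i = a by [].
have ew : wedge w = a ^+ 2 - p2.
  transitivity (\sum_i w i * (a - w i)); last first.
    under eq_bigr do rewrite mulrBr.
    by rewrite sumrB -mulr_suml -expr2; congr (_ - _); apply: eq_bigr => l _; rewrite expr2.
  apply: eq_bigr => l _; rewrite -sum_neq !mulr_sumr; apply: eq_bigr => b _.
  by rewrite !mulrA wA.
have tw : wtri w = a ^+ 3 - 3 * a * p2 + 2 * p3.
  transitivity (\sum_i w i * (a ^+ 2 - p2 - 2 * a * w i + 2 * w i ^+ 2)); last first.
    transitivity (\sum_i ((a ^+ 2 - p2) * w i - 2 * a * w i ^+ 2 + 2 * w i ^+ 3)).
      by apply: eq_bigr => l _; ring.
    by rewrite big_split sumrB /= -!mulr_sumr -/p2 -/p3 aE; ring.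
  apply: eq_bigr => l _.
  transitivity (w l * \sum_b w b * (a - w l - w b) * (l != b)%:R); last first.
    rewrite sum_neq; congr (_ * _).
    transitivity (\sum_b ((a - w l) * w b - w b ^+ 2) - w l * (a - w l - w l)).
      by congr (_ - _); apply: eq_bigr => b _; ring.
    by rewrite sumrB -mulr_sumr -/p2 aE; ring.
  rewrite /wquad !mulr_sumr; apply: eq_bigr => b _.
  have [->|nlb] := eqVneq l b.
    by rewrite mulr0 mulr0 mulr_sumr mulr_sumr big1 // => c _; rewrite /Gtri irrA /= mulr0n; ring.
  have -> : a - w l - w b = \sum_c w c * (l != c)%:R * (b != c)%:R.
    by rewrite sum_neq sum_neq nlb mulr1.
  rewrite mulr1 !mulrA !mulr_sumr; apply: eq_bigr => c _.
  rewrite /Gtri.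
  have -> : w l * w b * (w c * ((A l b)%:R * (A b c)%:R * (A l c)%:R))
     = (w l * w b * (A l b)%:R) * (w c * (A b c)%:R * (A l c)%:R) by ring.
  rewrite wA nlb mulr1.
  have -> : w l * w b * (w c * (A b c)%:R * (A l c)%:R)
     = (w b * w c * (A b c)%:R) * (w l * (A l c)%:R) by ring.
  rewrite wA.
  have -> : w b * w c * (b != c)%:R * (w l * (A l c)%:R)
     = (w l * w c * (A l c)%:R) * (w b * (b != c)%:R) by ring.
  by rewrite wA; ring.
have a_ge0 : 0 <= a by apply: sumr_ge0.
have -> : chord w = 2 * \sum_i w i * (a - k * w i) * (a - (k + 1) * w i).
  transitivity (2 * \sum_i (a ^+ 2 * w i - (2 * k + 1) * a * w i ^+ 2 + k * (k + 1) * w i ^+ 3)).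
    by rewrite big_split sumrB /= -!mulr_sumr -/p2 -/p3 aE /chord ew tw -/a; ring.
  by congr (_ * _); apply: eq_bigr => l _; ring.
apply: mulr_ge0 => //.
have [a0|a_neq0] := eqVneq a 0.
  have wz l : w l = 0.
    apply/eqP; rewrite eq_le w0 andbT -a0 /a /wsum (bigD1 l) //= lerDl.
    exact: sumr_ge0.
  by rewrite big1 // => l _; rewrite wz !mul0r.
have a_gt0 : 0 < a by rewrite lt0r a_neq0.
(* The cubic inequality assumes [2 <= K]; for [K = 1] the sum is the triangle weight itself. *)
have [K1|K2] := ltnP K 2.
  have k1 : k = 1 by rewrite /k; case: (K) K_gt0 K1 => [|[|]].
  have tri_ge0 : 0 <= wtri w.
    apply: sumr_ge0 => l _; apply: mulr_ge0 => //; apply: sumr_ge0 => b _.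
    apply: mulr_ge0 => //; apply: sumr_ge0 => c _; apply: mulr_ge0 => //.
    by rewrite !mulr_ge0 ?ler0n.
  have -> : \sum_i w i * (a - k * w i) * (a - (k + 1) * w i) = wtri w.
    transitivity (\sum_i (a ^+ 2 * w i - 3 * a * w i ^+ 2 + 2 * w i ^+ 3)).
      by apply: eq_bigr => l _; rewrite k1; ring.
    by rewrite big_split sumrB /= -!mulr_sumr -/p2 -/p3 aE tw; ring.
  exact: tri_ge0.
have -> : \sum_i w i * (a - k * w i) * (a - (k + 1) * w i)
  = a ^+ 3 * \sum_i (w i / a) * (1 - K%:R * (w i / a)) * (1 - K.+1%:R * (w i / a)).
  rewrite mulr_sumr; apply: eq_bigr => l _; rewrite -natr1 -/k.
  by field.
apply: mulr_ge0; first exact: exprn_ge0.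
apply: sum_cubic_ge0 => // [l|]; first exact: divr_ge0.
by rewrite -mulr_suml divff.
Qed.

(* Zykov symmetrization: on two nonadjacent vertices the functional is affine
   in the way their total weight is shared. *)
Lemma chord_ge0 w : (forall l, 0 <= w l) -> 0 <= chord w.
Proof.
move: {2}#|_|.+1 (ltnSn #|[set l | w l != 0]|) => n.
elim: n w => // n IH w; rewrite ltnS => hn w0.
case: (pickP (fun p : I * I => [&& p.1 != p.2, ~~ A p.1 p.2, w p.1 != 0 & w p.2 != 0])).
  move=> [i j] /= /and4P[nij Aij wi wj].
  pose r l := if l == i then 0 else if l == j then 0 else w l.
  have nji : (j == i) = false by rewrite eq_sym (negbTE nij).
  have ri : r i = 0 by rewrite /r eqxx.
  have rj : r j = 0 by rewrite /r nji eqxx.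
  have ew : w = two_pt i j r (w i) (w j).
    apply: functional_extensionality => l; rewrite /two_pt /r.
    by case: eqP => [->//|]; case: eqP => [->//|].
  have s_gt0 : 0 < w i + w j by rewrite ltr_wpDr // lt0r wi w0.
  rewrite ew -(pmulr_rge0 _ s_gt0) chord_two_pt //.
  have r0 l : 0 <= r l by rewrite /r; do 2?case: eqP.
  have key x y (z : I) : 0 <= x -> 0 <= y -> w z != 0 -> two_pt i j r x y z = 0 ->
      (z = i \/ z = j) -> 0 <= chord (two_pt i j r x y).
    move=> x0 y0 wz tz zij; apply: IH; last first.
      by move=> l; rewrite /two_pt; do 2?case: eqP.
    apply: leq_trans hn; apply: proper_card; apply/properP; split.
      apply/subsetP => l; rewrite !inE /two_pt /r.
      by case: (l =P i) => [->//|_]; case: (l =P j) => [->//|_].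
    by exists z; rewrite !inE ?tz ?eqxx.
  apply: addr_ge0; apply: mulr_ge0 => //.
    by apply: (key _ _ j) => //; rewrite ?addr_ge0 // /two_pt ?nji ?eqxx //; right.
  by apply: (key _ _ i) => //; rewrite ?addr_ge0 // /two_pt ?eqxx //; left.
move=> h; apply: chord_clique => // i j nij Aij.
have /negbT := h (i, j); rewrite /= nij Aij /= negb_and !negbK.
by case/orP => /eqP ->; rewrite ?mulr0 ?mul0r.
Qed.

(** This is [a] times the chord inequality. For nonzero [q] the left side is
    [2 q^2 (K + 1 - a^2 / q) (a^2 / q - K)], positive exactly when [a^2 / q] lies strictly between
    [K] and [K + 1]. *)
Lemma wedge_chord w a e q : (forall l, 0 <= w l) ->
  a = wsum w -> e = wedge w -> q = a ^+ 2 - e ->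
  2 * ((k + 1) * q - a ^+ 2) * (a ^+ 2 - k * q)
    <= k * (k + 1) * (a * wtri w - 2 * e ^+ 2 + a ^+ 2 * e).
Proof.
move=> w0 ea ee eq; rewrite -subr_ge0.
have -> : k * (k + 1) * (a * wtri w - 2 * e ^+ 2 + a ^+ 2 * e)
   - 2 * ((k + 1) * q - a ^+ 2) * (a ^+ 2 - k * q) = a * chord w.
  by rewrite /chord -ea -ee eq; ring.
by rewrite ea; apply: mulr_ge0; [apply: sumr_ge0 | apply: chord_ge0].
Qed.

End Chord.

(** * The witness *)

Definition root_edge : pgraph := ([:: 0; 1], [:: (0, 1)], [:: (0, 1)])%N.
Definition root_tri : pgraph :=
  ([:: 0; 1; 2], [:: (0, 1); (0, 2); (1, 2)], [:: (0, 1)])%N.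
Definition root_K4 : pgraph :=
  ([:: 0; 1; 2; 3], [:: (0, 1); (0, 2); (0, 3); (1, 2); (1, 3); (2, 3)],
   [:: (0, 1)])%N.

(** A syntax for polynomials in the three rooted graphs, so that well-formedness, labels and
    evaluation of the large formal sums follow by induction instead of expansion. *)
Inductive rpoly :=
  | REdge | RTri | RK4
  | RAdd of rpoly & rpoly | RMul of rpoly & rpoly | RScale of R & rpoly.

Fixpoint rfsum (p : rpoly) : fsum :=
  match p with
  | REdge => [:: (R1, root_edge)]
  | RTri => [:: (R1, root_tri)]
  | RK4 => [:: (R1, root_K4)]
  | RAdd p q => rfsum p ++ rfsum q
  | RMul p q => fmul (rfsum p) (rfsum q)
  | RScale c p => [seq (Rmult c u.1, u.2) | u <- rfsum p]
  end.

Fixpoint reval (a e t : R) (p : rpoly) : R :=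
  match p with
  | REdge => a
  | RTri => e
  | RK4 => t
  | RAdd p q => reval a e t p + reval a e t q
  | RMul p q => reval a e t p * reval a e t q
  | RScale c p => c * reval a e t p
  end.

(** The exponent is shifted, as the syntax has no unit: [rexp p n] stands for [p ^ (n + 1)]. *)
Fixpoint rexp (p : rpoly) (n : nat) : rpoly :=
  if n is n'.+1 then RMul p (rexp p n') else p.

Lemma inF_rfsum p : inF (rfsum p).
Proof.
elim: p => //= [p IHp q IHq|p IHp q IHq|c p IHp].
- by rewrite /inF all_cat; apply/andP.
- exact: inF_fmul.
- by rewrite /inF all_map.
Qed.

Lemma labs_rfsum p u : u \in rfsum p -> {subset labs u.2 <= [:: 1%N]}.
Proof.
elim: p u => [|||p IHp q IHq|p IHp q IHq|c p IHp] u /=.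
- by rewrite inE => /eqP -> a.
- by rewrite inE => /eqP -> a.
- by rewrite inE => /eqP -> a.
- by rewrite mem_cat => /orP[/IHp|/IHq].
- case/allpairsP => -[u1 u2] /= [i1 i2 ->] a /labs_pprod.
  by rewrite mem_cat => /orP[/(IHp _ i1)|/(IHq _ i2)].
- by case/mapP => v /IHp h ->.
Qed.

Lemma inF0_funlabel f : inF f -> inF0 (funlabel f).
Proof.
move=> /allP h; apply/allP => _ /mapP[u /h /and5P[h1 h2 _ _ _] ->] /=.
by rewrite eqxx andbT; apply/and5P.
Qed.

Lemma inF0_fmul f g : inF0 f -> inF0 g -> inF0 (fmul f g).
Proof.
move=> /allP wff /allP wfg; apply/allP => s /allpairsP[[u v] /= [/wff/andP[h1 /eqP l1]]].
move=> /wfg/andP[h2 /eqP l2] ->.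
by apply/andP; split; [apply: wf_pprod | apply/eqP/Ls_pprod0].
Qed.

Definition rQ : rpoly := RAdd (rexp REdge 1) (RScale (-1) RTri).
Definition rD : rpoly :=
  RAdd (RMul REdge RK4)
    (RAdd (RScale (-2) (rexp RTri 1)) (RMul (rexp REdge 1) RTri)).
Definition rQD : rpoly := RAdd (rexp rQ 1) rD.

Definition runlab (p : rpoly) : fsum := funlabel (rfsum p).

(* With [a] the degree of the root, [k := a ^ 2 / q] is the number of parts
   when its neighbourhood is a balanced complete multipartite graph, and then
   [d = 0].  Averaging over two independent roots, [witness] is the mean of
   [a * q ^ 4 * q' ^ 4 * ((k - k') * (k - k' - 1) + d * a ^ 4 / q ^ 4
     + d' * a' ^ 4 / q' ^ 4)]. *)
Definition witness : fsum :=
  fmul (runlab (RAdd (RMul rQD (rexp REdge 4))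
                  (RScale (-1) (RMul (rexp rQ 2) (rexp REdge 2)))))
       (runlab (rexp rQ 3))
  ++ fmul (runlab (RScale (-2) (RMul (rexp rQ 2) (rexp REdge 2))))
          (runlab (RMul (rexp rQ 2) (rexp REdge 1)))
  ++ fmul (runlab (RMul (rexp rQ 3) REdge))
          (runlab (RAdd (RMul rQD (rexp REdge 3)) (RMul (rexp rQ 2) (rexp REdge 1)))).

(** The leading [a] breaks the symmetry between the roots. Without it, averaging both orders would
    turn [(k - k') (k - k' - 1)] into [(k - k')^2], which is never negative. *)
Definition wit (a q d b q' d' : R) : R :=
  a * (q ^+ 2 * q' ^+ 2 * (q' * a ^+ 2 - q * b ^+ 2) * (q' * a ^+ 2 - q * b ^+ 2 - q * q')
       + d * q' ^+ 4 * a ^+ 4 + d' * q ^+ 4 * b ^+ 4).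

Lemma inF0_runlab p : inF0 (runlab p).
Proof. exact/inF0_funlabel/inF_rfsum. Qed.

Lemma inF0_witness : inF0 witness.
Proof.
have cat f g : inF0 f -> inF0 g -> inF0 (f ++ g) by rewrite /inF0 all_cat => -> ->.
have mul p q : inF0 (fmul (runlab p) (runlab q)).
  exact: inF0_fmul (inF0_runlab p) (inF0_runlab q).
exact: cat (mul _ _) (cat _ _ (mul _ _) (mul _ _)).
Qed.

Section Eval.
Variables (B : Type) (r : B -> B -> bool) (x0 : B).
Variables (pts : seq B) (wt : B -> R) (om kap : R).
Hypothesis sym_r : symmetric r.
Hypothesis mass1 : \sum_(x <- pts) wt x + om * kap = 1.
Local Notation EV := (jev r x0 pts wt om kap).
Local Notation JL := (jldens r x0 pts wt om kap).
Local Notation c0 := (fun=> inl x0).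

Lemma jlev_rfsum p m psi : ok m psi ->
  jlev r x0 pts wt om kap (rfsum p) m psi
  = reval (JL root_edge m psi) (JL root_tri m psi) (JL root_K4 m psi) p.
Proof.
move=> o; elim: p => [|||p IHp q IHq|p IHp q IHq|c p IHp] /=;
  rewrite ?(jlev_cat, jlev_fmul, IHp, IHq) ?inF_rfsum //.
- by rewrite /jlev big_seq1 mul1r.
- by rewrite /jlev big_seq1 mul1r.
- by rewrite /jlev big_seq1 mul1r.
- rewrite -IHp /jlev big_map mulr_sumr; apply: eq_bigr => u _.
  by rewrite /= RmultE mulrA.
Qed.

Definition bdeg (x : B) : R := \sum_(y <- pts) wt y * (r x y)%:R.
Definition btri (x : B) : R :=
  \sum_(y <- pts) wt y * \sum_(z <- pts) wt z * ([&& r x y, r x z & r y z])%:R.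
Definition bK4 (x : B) : R :=
  \sum_(y <- pts) wt y * \sum_(z <- pts) wt z * \sum_(u <- pts)
    wt u * ([&& r x y, r x z, r x u, r y z, r y u & r z u])%:R.

(* The root integral sees the interpolated parts as one point of weight [om * kap]. *)
Definition rint (f : R -> R -> R -> R) : R :=
  \sum_(x <- pts) wt x * f (bdeg x) (btri x) (bK4 x)
  + om * kap * f (om * (kap - 1)) (om ^+ 2 * (kap - 1) * (kap - 2))
               (om ^+ 3 * (kap - 1) * (kap - 2) * (kap - 3)).

Lemma JL_base psi x : psi 1%N = inl x ->
  [/\ JL root_edge 0 psi = bdeg x, JL root_tri 0 psi = btri x & JL root_K4 0 psi = bK4 x].
Proof.
move=> e; rewrite /jldens /unlabeled /=.
rewrite /homind /= /upd /= /lasg /= e /=.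
have s0 : \sum_(y <- pts) wt y * 0 = 0 by rewrite big1 // => y _; rewrite mulr0.
have E := (big_cons, big_nil, s0, mulr0, addr0).
split.
- rewrite !E; by apply: eq_bigr => y _; rewrite andbT.
- rewrite -[RHS]addr0; congr (_ + _); last by rewrite !E.
  apply: eq_bigr => y _; congr (_ * _); rewrite andbF /= !E.
  by apply: eq_bigr => z _; rewrite andbT.
- rewrite -[RHS]addr0; congr (_ + _); last by rewrite !E.
  apply: eq_bigr => y _; congr (_ * _); rewrite andbF /= -[RHS]addr0.
  congr (_ + _); last by rewrite !E.
  apply: eq_bigr => z _; congr (_ * _); rewrite !andbF /= !E.
  by apply: eq_bigr => u _; rewrite andbT.
Qed.

(** The root occupies part 0, so one part has been met and the [kap - 1] others form its
    neighbourhood; base points are not adjacent to it. *)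
Lemma JL_part psi : psi 1%N = inr 0%N ->
  [/\ JL root_edge 1 psi = om * (kap - 1),
      JL root_tri 1 psi = om ^+ 2 * (kap - 1) * (kap - 2) &
      JL root_K4 1 psi = om ^+ 3 * (kap - 1) * (kap - 2) * (kap - 3)].
Proof.
move=> e; rewrite /jldens /unlabeled /=.
rewrite /homind /= /upd /= /lasg /= e /=.
have s0 : \sum_(y <- pts) wt y * 0 = 0 by rewrite big1 // => y _; rewrite mulr0.
have E := (big_cons, big_nil, s0, mulr0, mul0r, addr0, add0r).
by split; rewrite !E; ring.
Qed.

Lemma jev_runlab p : EV (runlab p) = rint (fun a e t => reval a e t p).
Proof.
rewrite /runlab (@jev_funlabel _ _ _ _ _ _ _ mass1 _ [:: 1%N]) ?inF_rfsum //; last exact: labs_rfsum.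
rewrite (@eq_jint _ _ _ _ _ _ _ (fun m psi => reval (JL root_edge m psi) (JL root_tri m psi)
   (JL root_K4 m psi) p)) //; last by move=> m psi o; apply: jlev_rfsum.
rewrite /= big_nil add0r subr0 mulrA; congr (_ + _ * _).
  apply: eq_bigr => x _; congr (_ * _).
  by have [-> -> ->] := @JL_base (upd (fun=> inl x0) 1 (inl x)) x erefl.
by have [-> -> ->] := @JL_part (upd (fun=> inl x0) 1 (inr 0%N)) erefl.
Qed.

Lemma rintD f g : rint (fun a e t => f a e t + g a e t) = rint f + rint g.
Proof.
rewrite /rint; under eq_bigr do rewrite mulrDr.
by rewrite big_split /=; ring.
Qed.

Lemma rintZ c f : rint (fun a e t => c * f a e t) = c * rint f.
Proof.
rewrite /rint [RHS]mulrDr [in RHS]mulr_sumr; congr (_ + _); last by ring.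
by apply: eq_bigr => x _; ring.
Qed.

Lemma eq_rint f g : (forall a e t, f a e t = g a e t) -> rint f = rint g.
Proof. by move=> fg; rewrite /rint fg; congr (_ + _); apply: eq_bigr => x _; rewrite fg. Qed.

Definition qof (a e : R) : R := a ^+ 2 - e.
Definition dof (a e t : R) : R := a * t - 2 * e ^+ 2 + a ^+ 2 * e.

Lemma jev_witness : EV witness =
  rint (fun a e t => rint (fun b e' t' =>
    wit a (qof a e) (dof a e t) b (qof b e') (dof b e' t'))).
Proof.
rewrite /witness !(jev_cat, jev_fmul) ?inF0_runlab // !jev_runlab.
have sep f g : rint f * rint g = rint (fun a e t => rint (fun b e' t' => f a e t * g b e' t')).
  by rewrite mulrC -rintZ; apply: eq_rint => a e t; rewrite rintZ mulrC.
rewrite !sep -!rintD; apply: eq_rint => a e t; rewrite -!rintD; apply: eq_rint => b e' t'.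
by rewrite /wit /qof /dof /=; ring.
Qed.

End Eval.

(** * Densities in finite graphs *)

Fixpoint upds (C : Type) (rho : nat -> C) (V : seq nat) (s : seq C) : nat -> C :=
  if V is v :: V' then
    if s is c :: s' then upds (upd rho v c) V' s' else rho
  else rho.

Lemma upds_notin C (rho : nat -> C) V s w : w \notin V -> upds rho V s w = rho w.
Proof.
elim: V s rho => [//|v V IH] [|c s] rho //=; rewrite inE negb_or => /andP[nwv wV].
by rewrite IH // /upd (negbTE nwv).
Qed.

Lemma upds_nth C (rho : nat -> C) c0 V s w : uniq V -> size s = size V -> w \in V ->
  upds rho V s w = nth c0 s (index w V).
Proof.
elim: V s rho => [//|v V IH] [|c s] rho //= /andP[nv uV] [es]; rewrite inE eq_sym.
have [e|nvw] /= := eqVneq v w => wV; last exact: IH.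
by rewrite -e upds_notin // /upd eqxx.
Qed.

Lemma sum_tupleS (n : nat) (T : finType) (f : n.+1.-tuple T -> R) :
  \sum_t f t = \sum_x \sum_(t : n.-tuple T) f (cons_tuple x t).
Proof.
rewrite pair_big /= (reindex (fun p : T * n.-tuple T => cons_tuple p.1 p.2)) //=.
exists (fun t : n.+1.-tuple T => (thead t, behead_tuple t)).
  by move=> [x t] _ /=; congr (_, _); apply: val_inj.
by move=> t _; rewrite /= [RHS]tuple_eta; apply: val_inj.
Qed.

(** With part weight zero only the base points remain. The map [iot] allows [J] to sit in a larger
    base whose other points carry no weight. *)
Lemma jint_tuple B (pts : seq B) wt kap (J : finType) (w : J -> R) (iot : J -> B)
    V F m (rho : nat -> B + nat) :
  (forall f : B -> R, \sum_(x <- pts) wt x * f x = \sum_j w j * f (iot j)) ->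
  jint pts wt 0 kap V (fun=> F) m rho
  = \sum_(t : (size V).-tuple J)
      (\prod_(j <- t) w j) * F (upds rho V [seq inl (iot j) | j <- t]).
Proof.
move=> hw; elim: V m rho => [|v V IH] m rho /=.
  rewrite (big_pred1 [tuple]) ?big_nil ?mul1r // => t.
  by apply/esym/eqP; apply: tuple0.
rewrite mul0r addr0.
rewrite (hw (fun x => jint pts wt 0 kap V (fun=> F) m (upd rho v (inl x)))).
rewrite sum_tupleS; apply: eq_bigr => j _; rewrite IH mulr_sumr.
by apply: eq_bigr => t _; rewrite /= big_cons mulrA.
Qed.

Lemma homcount_sum H n adjG : wf H -> (homcount H n.+1 adjG)%:R =
  \sum_(t : (size (Vs H)).-tuple 'I_n.+1)
    homind (adjC (fun i j : 'I_n.+1 => adjG i j)) (Es H)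
      (upds (fun=> inl ord0) (Vs H) [seq inl j | j <- t]).
Proof.
move=> wfH; rewrite /homcount -sum1_card natr_sum big_mkcond /=.
set s := size (Vs H).
rewrite [RHS](reindex (fun phi : {ffun 'I_s -> 'I_n.+1} => [tuple phi i | i < s])); last first.
  exists (fun t : s.-tuple 'I_n.+1 => [ffun i => tnth t i]) => [phi _|t _].
    by apply/ffunP => i; rewrite ffunE tnth_mktuple.
  by apply: eq_from_tnth => i; rewrite tnth_mktuple ffunE.
apply: eq_bigr => phi _.
have imgE u : u \in Vs H -> upds (fun=> inl ord0 : 'I_n.+1 + nat) (Vs H)
    [seq inl j | j <- [tuple phi i | i < s]] u
  = inl (nth ord0 [seq phi i | i <- enum 'I_s] (index u (Vs H))).
  move=> uV; rewrite (upds_nth _ (inl ord0)) ?wf_uniq //; last by rewrite size_map size_tuple.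
  by rewrite (nth_map ord0) // size_map size_enum_ord /s index_mem.
transitivity ((all (fun e : nat * nat => adjG (img phi e.1) (img phi e.2)) (Es H))%:R : R);
  last first.
  congr (nat_of_bool _)%:R; apply: eq_in_all => e /(allP (wf_edges wfH))/andP[h1 h2].
  have imE u : u \in Vs H -> img phi u = nth ord0 [seq phi i | i <- enum 'I_s] (index u (Vs H)).
    by move=> uV; rewrite /img (map_comp val phi) (nth_map ord0) // size_map size_enum_ord index_mem.
  by rewrite !imgE //= !imE.
by rewrite inE; case: all.
Qed.

Lemma tdens_jdens H n adjG kap : wf H ->
  tdens H n.+1 adjG = jdens (fun i j : 'I_n.+1 => adjG i j) ord0
    (index_enum 'I_n.+1) (fun=> n.+1%:R^-1) 0 kap H.
Proof.
move=> wfH; rewrite /tdens /jdens (@jint_tuple _ _ _ _ _ (fun=> n.+1%:R^-1) id) //.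
rewrite !INRE RdivE RpowE homcount_sum // mulrC mulr_sumr; apply: eq_bigr => t _.
by rewrite big_const_seq count_predT size_tuple iter_mulr_1 exprVn.
Qed.

Lemma tsum_jev f n adjG kap : inF f ->
  tsum f n.+1 adjG = jev (fun i j : 'I_n.+1 => adjG i j) ord0
    (index_enum 'I_n.+1) (fun=> n.+1%:R^-1) 0 kap f.
Proof.
elim: f => [|p f IH] /=; first by rewrite /jev big_nil.
by case/andP => wp wf; rewrite /jev big_cons /= RplusE RmultE (tdens_jdens _ _ kap wp) IH.
Qed.

Lemma sub_inF0 f : inF0 f -> inF f.
Proof. by apply: sub_all => p /andP[]. Qed.

(** * Positivity of the witness *)

(** What positivity needs to know about a root: it is isolated, or its neighbourhood satisfies the
    chord inequalities for every [K]. *)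
Definition rooted_ok (a q d : R) :=
  (a = 0 /\ q = 0 /\ d = 0) \/
  (0 < a /\ 0 < q <= a ^+ 2 /\ forall K : nat, (0 < K)%N ->
    2 * ((K%:R + 1) * q - a ^+ 2) * (a ^+ 2 - K%:R * q) <= K%:R * (K%:R + 1) * d).

(** Take [K] as the integer part of [k = a^2 / q], which is at least 1. The chord inequality for
    this [K] reads [2 f (1 - f) q^2 <= K (K + 1) d], and [K (K + 1) <= 2 k^2], while
    [a^4 = k^2 q^2]. *)
Lemma rooted_gap (a q d : R) : 0 < a -> 0 < q <= a ^+ 2 ->
  (forall K : nat, (0 < K)%N ->
    2 * ((K%:R + 1) * q - a ^+ 2) * (a ^+ 2 - K%:R * q) <= K%:R * (K%:R + 1) * d) ->
  exists (K : nat) (f : R), [/\ a ^+ 2 = (K%:R + f) * q, 0 <= f <= 1 &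
    f * (1 - f) * q ^+ 4 <= d * a ^+ 4].
Proof.
move=> a0 /andP[q0 qa] h; set k := a ^+ 2 / q.
have k1 : 1 <= k by rewrite /k ler_pdivlMr // mul1r.
have k0 : 0 <= k by lra.
have ka : a ^+ 2 = k * q by rewrite /k divfK // gt_eqF.
have /andP[hK1 hK2] := truncn_itv k0.
set K := Num.truncn k in hK1 hK2.
have K0 : (0 < K)%N by move: hK2; rewrite -(ltr_nat R); case: (K) => //; lra.
have KR : 1 <= K%:R :> R by rewrite ler1n.
rewrite -natr1 in hK2.
exists K, (k - K%:R); split; first by rewrite ka; ring.
  by apply/andP; split; lra.
have := h K K0; rewrite ka; set f := k - K%:R.
have f0 : 0 <= f by rewrite /f; lra.
have f1 : 0 <= 1 - f by rewrite /f; lra.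
have -> : 2 * ((K%:R + 1) * q - k * q) * (k * q - K%:R * q) = 2 * (f * (1 - f) * q ^+ 2).
  by rewrite /f; ring.
have ff : 0 <= f * (1 - f) * q ^+ 2 by apply: mulr_ge0; [apply: mulr_ge0 | exact: sqr_ge0].
move=> h1.
have d0 : 0 <= d.
  have : 0 <= K%:R * (K%:R + 1) * d by lra.
  by rewrite pmulr_rge0 //; nra.
have : f * (1 - f) * q ^+ 2 <= d * k ^+ 2.
  have h2 : K%:R * (K%:R + 1) <= 2 * k ^+ 2 by nra.
  have h3 : K%:R * (K%:R + 1) * d <= 2 * k ^+ 2 * d by rewrite ler_wpM2r.
  lra.
move=> h2; have -> : a ^+ 4 = k ^+ 2 * q ^+ 2 by rewrite -exprMn -ka; ring.
have -> : f * (1 - f) * q ^+ 4 = (f * (1 - f) * q ^+ 2) * q ^+ 2 by ring.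
by rewrite mulrA ler_wpM2r // sqr_ge0.
Qed.

(** With [j = K - L] the right side equals [j (j - 1 + 2 f - 2 g) + 2 g (1 - f)]. The critical cases
    are [j = 0] and [j = 1], which give [2 g (1 - f)] and [2 f (1 - g)]. *)
Lemma frac_gap_ge0 (K L : nat) (f g : R) : 0 <= f <= 1 -> 0 <= g <= 1 ->
  0 <= (K%:R + f - (L%:R + g)) * (K%:R + f - (L%:R + g) - 1)
       + f * (1 - f) + g * (1 - g).
Proof.
move=> /andP[f0 f1] /andP[g0 g1].
have fg : 0 <= f * (1 - g) by rewrite mulr_ge0 // subr_ge0.
have gf : 0 <= g * (1 - f) by rewrite mulr_ge0 // subr_ge0.
have [LK|] := leqP L K; last first.
  rewrite -(ler_nat R) -natr1 => h; set j := L%:R - K%:R : R.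
  have j1 : 1 <= j by rewrite /j; lra.
  suff : 0 <= j * (j + 1 - 2 * f + 2 * g) + 2 * (g * (1 - f)) by rewrite /j; lra.
  by apply: addr_ge0; [apply: mulr_ge0; lra | lra].
rewrite -(subnKC LK) natrD; move: (K - L)%N => j.
suff : 0 <= j%:R * (j%:R - 1 + 2 * f - 2 * g) + 2 * (g * (1 - f)) by lra.
case: j => [|[|[|j]]].
- by rewrite mul0r; lra.
- lra.
- lra.
- apply: addr_ge0; last lra; apply: mulr_ge0; first exact: ler0n.
  have : 3 <= j.+3%:R :> R by rewrite ler_nat.
  lra.
Qed.

Lemma wit_ge0 a q d b q' d' : rooted_ok a q d -> rooted_ok b q' d' ->
  0 <= wit a q d b q' d'.
Proof.
rewrite /wit => -[[-> _]|[a0 [q0 h]]]; first by rewrite mul0r.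
move=> -[[-> [-> ->]]|[b0 [q0' h']]].
  by apply: mulr_ge0; [exact: ltW | rewrite !(expr0n, mul0r, mulr0, addr0)].
have [K [f [ea f01 hd]]] := rooted_gap a0 q0 h.
have [L [g [eb g01 hd']]] := rooted_gap b0 q0' h'.
apply: mulr_ge0; first exact: ltW.
have Q : 0 <= q ^+ 4 by apply: exprn_ge0; case/andP: q0 => /ltW.
have Q' : 0 <= q' ^+ 4 by apply: exprn_ge0; case/andP: q0' => /ltW.
have h1 : f * (1 - f) * q ^+ 4 * q' ^+ 4 <= d * a ^+ 4 * q' ^+ 4 by rewrite ler_wpM2r.
have h2 : g * (1 - g) * q' ^+ 4 * q ^+ 4 <= d' * b ^+ 4 * q ^+ 4 by rewrite ler_wpM2r.
have := mulr_ge0 (mulr_ge0 Q Q') (frac_gap_ge0 K L f01 g01).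
rewrite ea eb; set k := K%:R + f; set l := L%:R + g.
have -> : q ^+ 2 * q' ^+ 2 * (q' * (k * q) - q * (l * q')) *
    (q' * (k * q) - q * (l * q') - q * q')
   = q ^+ 4 * q' ^+ 4 * ((k - l) * (k - l - 1)) by ring.
move: h1 h2; lra.
Qed.

(** The neighbourhood of [x], each neighbour weighted by [1 / (n + 1)], is a weighted graph whose
    edge and triangle weights are the triangle and [K_4] densities rooted at [x]. *)
Lemma rooted_graph n (adjG : nat -> nat -> bool) (x : 'I_n.+1) :
  simple_graph n.+1 adjG ->
  let r := fun i j : 'I_n.+1 => adjG i j in
  let wt := fun=> n.+1%:R^-1 in
  let pts := index_enum 'I_n.+1 in
  let a := bdeg r pts wt x in let e := btri r pts wt x in
  rooted_ok a (qof a e) (dof a e (bK4 r pts wt x)).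
Proof.
move=> [_ [symG irrG]] r wt pts a e.
pose w (i : 'I_n.+1) : R := n.+1%:R^-1 * (adjG x i)%:R.
have w0 i : 0 <= w i by rewrite /w mulr_ge0 ?invr_ge0 ?ler0n.
have sr : symmetric r by move=> i j; apply: symG.
have ir : irreflexive r by move=> i; apply: irrG.
have ea : a = wsum w by [].
have nb (b1 b2 : bool) : (b1 && b2)%:R = b1%:R * b2%:R :> R by rewrite -natrM mulnb.
have ee : e = wedge r w.
  apply: eq_bigr => i _; rewrite /w -!mulrA; congr (_ * _).
  by rewrite mulr_sumr; apply: eq_bigr => j _; rewrite /wt !nb /r; ring.
have et : bK4 r pts wt x = wtri r w.
  apply: eq_bigr => i _; rewrite /w -!mulrA; congr (_ * _).
  rewrite mulr_sumr; apply: eq_bigr => j _; rewrite !mulr_sumr.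
  by apply: eq_bigr => l _; rewrite /wt !nb /Gtri /r; ring.
have a0 : 0 <= a by rewrite ea; apply: sumr_ge0.
have [az|anz] := eqVneq a 0.
  left; split=> //.
  have wz i : w i = 0.
    apply/eqP; rewrite eq_le w0 andbT -az ea /wsum (bigD1 i) //= lerDl.
    exact: sumr_ge0.
  have ez : e = 0 by rewrite ee /wedge /wquad big1 // => i _; rewrite wz mul0r.
  by rewrite /qof /dof az ez; split; ring.
have agt0 : 0 < a by rewrite lt0r anz.
right; split=> //; rewrite /qof; split.
  have e0 : 0 <= e.
    rewrite ee; apply: sumr_ge0 => i _; apply: mulr_ge0 => //; apply: sumr_ge0 => j _.
    by rewrite mulr_ge0 ?ler0n.
  apply/andP; split; last by lra.
  (* No vertex is adjacent to itself, so the squares [w i ^ 2] in the expansion of [a ^ 2] are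
     missing from [e]; this makes [q] positive. *)
  have : e + \sum_i w i ^+ 2 <= a ^+ 2.
    rewrite ee /wedge /wquad -big_split /= expr2 {1}ea /wsum mulr_suml; apply: ler_sum => i _.
    rewrite expr2 -mulrDr ler_wpM2l // ea /wsum (bigD1 i) //= ir mulr0 add0r.
    rewrite [leRHS](bigD1 i) //= [leLHS]addrC lerD2l; apply: ler_sum => j _.
    by rewrite ler_piMr // lern1; case: (r i j).
  suff : 0 < \sum_i w i ^+ 2 by lra.
  rewrite lt0r sumr_ge0 ?andbT => [|i _]; last exact: sqr_ge0.
  apply: contra anz; rewrite psumr_eq0 => [|i _]; last exact: sqr_ge0.
  move=> /allP h; rewrite ea /wsum big1 // => i _; apply/eqP.
  by have := h i (mem_index_enum i); rewrite sqrf_eq0.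
move=> K K0; rewrite /dof et; exact: (wedge_chord sr ir K0 w0 ea ee).
Qed.

Lemma positive0_witness : positive0 witness.
Proof.
case=> [|n] adjG sG; first by case: sG.
apply/RleP; rewrite (tsum_jev _ _ 0); last exact: sub_inF0 inF0_witness.
rewrite jev_witness; last first.
  by rewrite mul0r addr0 sumr_const card_ord -(mulr_natr n.+1%:R^-1) mulVf // pnatr_eq0.
rewrite /rint !mul0r !addr0; apply: sumr_ge0 => x _; apply: mulr_ge0.
  by rewrite invr_ge0 ler0n.
rewrite mul0r addr0; apply: sumr_ge0 => y _; apply: mulr_ge0.
  by rewrite invr_ge0 ler0n.
by apply: wit_ge0; apply: rooted_graph.
Qed.

(** * The witness is negative in an interpolated model *)

Section Parts.
Variables (L n : nat) (rW : rel 'I_n.+1).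
Local Notation B := ('I_L.+1 + 'I_n.+1)%type.

(** The complete [(L+1)]-partite piece is represented by a clique, one point for each part, next to
    the arbitrary graph [rW]. *)
Definition relB (x y : B) : bool :=
  match x, y with
  | inl i, inl j => i != j
  | inr i, inr j => rW i j
  | _, _ => false
  end.

Definition wtB (beta : R) (w : 'I_n.+1 -> R) (x : B) : R :=
  match x with inl _ => beta | inr j => w j end.

Lemma relB_sym : symmetric rW -> symmetric relB.
Proof. by move=> s [i|i] [j|j] //=; rewrite eq_sym. Qed.

Lemma sumB beta w (f : B -> R) :
  \sum_(x <- index_enum B) wtB beta w x * f x
  = beta * \sum_i f (inl i) + \sum_j w j * f (inr j).
Proof. by rewrite big_sumType /= -mulr_sumr. Qed.

(** The root uses up one of the [L + 1] points, so [L] parts remain in its neighbourhood. *)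
Lemma wtB_parts beta (i : 'I_L.+1) (l : R) (w := fun=> 0 : R) : l = L%:R ->
  let pts := index_enum B in
  [/\ bdeg relB pts (wtB beta w) (inl i) = beta * l,
      btri relB pts (wtB beta w) (inl i) = beta ^+ 2 * l * (l - 1) &
      bK4 relB pts (wtB beta w) (inl i) = beta ^+ 3 * l * (l - 1) * (l - 2)].
Proof.
move=> lE pts.
have nb (b1 b2 : bool) : (b1 && b2)%:R = b1%:R * b2%:R :> R by rewrite -natrM mulnb.
have S f : \sum_(x <- pts) wtB beta w x * f x = beta * \sum_j f (inl j).
  by rewrite sumB [X in _ + X]big1 ?addr0 // => j _; rewrite mul0r.
have c1 (a : 'I_L.+1) : \sum_j (a != j)%:R = l.
  have := sum_neq (fun=> 1 : R) a; under eq_bigr do rewrite mul1r.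
  by move=> ->; rewrite sumr_const card_ord -natr1 lE; ring.
have c2 (a b : 'I_L.+1) : a != b -> \sum_j (a != j)%:R * (b != j)%:R = l - 1 :> R.
  by move=> nab; rewrite sum_neq c1 nab.
have c3 (a b c : 'I_L.+1) : a != b -> a != c -> b != c ->
    \sum_j (a != j)%:R * (b != j)%:R * (c != j)%:R = l - 2 :> R.
  by move=> nab nac nbc; rewrite sum_neq c2 // nac nbc /= mulr1n; ring.
split.
- by rewrite /bdeg S c1.
- rewrite /btri S /=.
  transitivity (beta * \sum_j beta * (l - 1) * (i != j)%:R).
    congr (_ * _); apply: eq_bigr => j _; rewrite S /= -mulrA; congr (_ * _).
    have [->|nij] := eqVneq i j; first by rewrite big1 ?mulr0 // => z _; rewrite eqxx.
    by rewrite mulr1 -(c2 i j) //; apply: eq_bigr => z _; rewrite /= nb.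
  by rewrite -mulr_sumr c1; ring.
- rewrite /bK4 S /=.
  transitivity (beta * \sum_j beta ^+ 2 * (l - 1) * (l - 2) * (i != j)%:R).
    congr (_ * _); apply: eq_bigr => j _; rewrite S /=.
    have [->|nij] := eqVneq i j.
      rewrite mulr0 -[RHS](mulr0 beta); congr (_ * _); apply: big1 => z _.
      rewrite S -[RHS](mulr0 beta); congr (_ * _); apply: big1 => u _ /=.
      by rewrite ?eqxx.
    transitivity (beta * \sum_z beta * (l - 2) * ((i != z)%:R * (j != z)%:R)).
      congr (_ * _); apply: eq_bigr => z _; rewrite S /= -mulrA; congr (_ * _).
      have [eiz|niz] := eqVneq i z; first by rewrite mul0r mulr0 big1.
      have [ejz|njz] := eqVneq j z; first by rewrite !mulr0 big1 // => u _; rewrite andbF.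
      rewrite !mulr1 -(c3 i j z) //; apply: eq_bigr => u _.
      by rewrite /= !nb mulrA.
    by rewrite -mulr_sumr c2 //= ?mulr1n; ring.
  by rewrite -mulr_sumr c1; ring.
Qed.

(** In both pieces [d = 0], with [k = L] for a root in the clique and [k = L + 1/2] for a root among
    the interpolated parts, so only mixed pairs of roots count. Up to a common positive factor the
    two orders give [3/4] and [-1/4], weighted by the degrees [beta L] and [3 beta (L + 1/2)]. The
    ratio 3 of the part weights makes the total [- 3/8 beta]. *)
Lemma witness_neg (beta : R) (w := fun=> 0 : R) (x0 : B) : (0 < L)%N -> 0 < beta ->
  \sum_(x <- index_enum B) wtB beta w x + 3 * beta * (L%:R + 3 / 2) = 1 ->
  jev relB x0 (index_enum B) (wtB beta w) (3 * beta) (L%:R + 3 / 2) witness < 0.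
Proof.
move=> L0 b0 mass1; rewrite jev_witness //; set l := L%:R : R.
have l0 : 0 < l by rewrite ltr0n.
have rintE f : rint relB (index_enum B) (wtB beta w) (3 * beta) (l + 3 / 2) f
  = (l + 1) * beta * f (beta * l) (beta ^+ 2 * l * (l - 1)) (beta ^+ 3 * l * (l - 1) * (l - 2))
    + 3 * beta * (l + 3 / 2) * f (3 * beta * (l + 1 / 2))
        ((3 * beta) ^+ 2 * (l + 1 / 2) * (l - 1 / 2))
        ((3 * beta) ^+ 3 * (l + 1 / 2) * (l - 1 / 2) * (l - 3 / 2)).
  rewrite /rint (sumB _ _ (fun x => f (bdeg _ _ _ x) (btri _ _ _ x) (bK4 _ _ _ x))).
  have Z (F : 'I_n.+1 -> R) : \sum_j w j * F j = 0 by rewrite big1 // => j _; rewrite mul0r.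
  rewrite Z addr0.
  congr (_ + _ * f _ _ _); last 3 first.
  - by field.
  - by field.
  - by field.
  rewrite [RHS]mulrAC mulrC; congr (_ * _).
  transitivity (\sum_(i : 'I_L.+1) f (beta * l) (beta ^+ 2 * l * (l - 1)) (beta ^+ 3 * l * (l - 1) * (l - 2))).
    by apply: eq_bigr => i _; have [-> -> ->] := wtB_parts beta i (erefl l).
  by rewrite sumr_const card_ord -[LHS]mulr_natl -natr1.
rewrite !rintE /wit /qof /dof.
match goal with |- is_true (?X < 0) => have -> : X = - (3 / 8 * beta * ((3 * beta) ^+ 2 * (l + 1 / 2)) ^+ 4 *
   (beta ^+ 2 * l) ^+ 4 * ((l + 1) * beta) * (3 * beta * (l + 3 / 2))) by field end.
rewrite oppr_lt0 !mulr_gt0 ?exprn_gt0 ?mulr_gt0 ?exprn_gt0 //; lra.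
Qed.

End Parts.

(** * Signs of real polynomials near zero *)

Lemma poly_bounded01 (p : {poly R}) :
  exists2 M, 0 <= M & forall s, 0 <= s <= 1 -> `|p.[s]| <= M.
Proof.
elim/poly_ind: p => [|p c [M M0 hM]].
  by exists 0 => // s _; rewrite horner0 normr0.
exists (M + `|c|) => [|s s01]; first by rewrite addr_ge0.
rewrite hornerMXaddC; apply: le_trans (ler_normD _ _) _; rewrite lerD2r normrM.
have := hM s s01; case/andP: s01 => s0 s1; rewrite (ger0_norm s0).
have := normr_ge0 p.[s]; nra.
Qed.

(** Writing the polynomial as [p * X + c], its value on [[0, 1]] is at most [c + M s]. The
    denominator [M + 1 - c] makes the bound strict and keeps the interval inside [[0, 1]]. *)
Lemma poly_neg_near0 (p : {poly R}) : p.[0] < 0 ->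
  exists2 d, 0 < d <= 1 & forall s, 0 <= s <= d -> p.[s] < 0.
Proof.
elim/poly_ind: p => [|p c _]; first by rewrite horner0 ltxx.
rewrite hornerMXaddC mulr0 add0r => c0.
have [M M0 hM] := poly_bounded01 p.
have D : 0 < M + 1 - c by lra.
exists (- c / (M + 1 - c)).
  by apply/andP; split; [apply: divr_gt0 => //; lra | rewrite ler_pdivrMr //; lra].
move=> s /andP[s0]; rewrite ler_pdivlMr // => hs; rewrite hornerMXaddC.
have s1 : s <= 1 by nra.
have := hM s; rewrite s0 s1 ler_norml => /(_ isT)/andP[_ h].
have hM' : p.[s] * s <= M * s by rewrite ler_wpM2r.
have [->|sn0] := eqVneq s 0; first by rewrite mulr0 add0r.
have sgt0 : 0 < s by rewrite lt0r sn0.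
have : 0 < s * (1 - c) by apply: mulr_gt0 => //; lra.
lra.
Qed.

(** * Vanishing of the multiplier on every weighted graph *)

Section KeyArgument.
Variables (n : nat) (rW : rel 'I_n.+1) (w : 'I_n.+1 -> R).
Hypotheses (symW : symmetric rW) (w_ge0 : forall j, 0 <= w j) (w1 : \sum_j w j = 1).
Variable L : nat.
Hypothesis L_gt0 : (0 < L)%N.

Local Notation B := ('I_L.+1 + 'I_n.+1)%type.
(** Normalizes the mass at [s = 0]: [L + 1] points of weight [beta0] and [L + 3/2] parts of weight
    [3 beta0]. *)
Let beta0 : R := (L%:R + 1 + 3 * (L%:R + 3 / 2))^-1.
Let kap : R := L%:R + 3 / 2.
Let x0 : B := inl ord0.
Let EV (s : R) := jev (relB rW) x0 (index_enum B)
  (wtB ((1 - s) * beta0) (fun j => s * w j)) (3 * ((1 - s) * beta0)) kap.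

Let L_ge0 : 0 <= L%:R :> R. Proof. exact: ler0n. Qed.

Let beta0_gt0 : 0 < beta0. Proof. by rewrite invr_gt0; have := L_ge0; lra. Qed.

Let mass1 s : \sum_(x <- index_enum B) wtB ((1 - s) * beta0) (fun j => s * w j) x
  + 3 * ((1 - s) * beta0) * kap = 1.
Proof.
rewrite big_sumType /= sumr_const card_ord -mulr_sumr w1 mulr1 -[_ *+ _]mulr_natl -natr1.
have : (L%:R + 1 + 3 * (L%:R + 3 / 2)) * beta0 = 1 by rewrite divff //; have := L_ge0; lra.
rewrite /kap => e.
transitivity ((1 - s) * ((L%:R + 1 + 3 * (L%:R + 3 / 2)) * beta0) + s); first by ring.
by rewrite e; ring.
Qed.

Let EV_poly f : ispoly (EV^~ f).
Proof.
have P1 : ispoly (fun s => 1 - s).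
  by exists (1 - 'X) => s; rewrite !hornerE.
have Pc c : ispoly (fun=> c) by apply: ispoly_const.
apply: jev_poly => //.
- move=> [i|j] /=; apply: ispolyM => //; exact: ispoly_id.
- by do 2?apply: ispolyM.
Qed.

(** As [L] bounds the number of labels, [kap = L + 3/2] exceeds it, and the average over the labels
    has nonnegative weights. *)
Lemma EV_sos s gs y : 0 <= s <= 1 -> all inF gs -> (size (sos_labs gs) <= L)%N ->
  eqA y (funlabel (sumsq gs)) -> 0 <= EV s y.
Proof.
move=> /andP[s0 s1] wfgs hL e; rewrite /EV (jev_eqA _ (relB_sym symW) (mass1 s) e).
apply: jev_sos_ge0 => //.
- by move=> [i|j] /=; apply: mulr_ge0 => //; rewrite ?subr_ge0 // ltW.
- by apply: mulr_ge0 => //; apply: mulr_ge0; [rewrite subr_ge0 | exact: ltW].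
- have : (size (sos_labs gs))%:R <= L%:R :> R by rewrite ler_nat.
  rewrite /kap; lra.
Qed.

Lemma EV_at1 f : inF f -> EV 1 f = jev rW ord0 (index_enum 'I_n.+1) w 0 0 f.
Proof.
move=> /allP wff; rewrite /EV /jev big_seq [RHS]big_seq; apply: eq_bigr => p /wff wp.
congr (_ * _); rewrite subrr mul0r mulr0 /jdens.
rewrite (@jint_tuple _ _ _ _ _ w (@inr 'I_L.+1 'I_n.+1)); last first.
  move=> f'; rewrite sumB mul0r add0r.
  by apply: eq_bigr => j _; rewrite mul1r.
rewrite [RHS](@jint_tuple _ _ _ _ _ w id) //.
apply: eq_bigr => t _; congr (_ * _); congr (nat_of_bool _)%:R.
apply: eq_in_all => e /(allP (wf_edges wp))/andP[h1 h2].
have U (C : Type) (c : C) (f' : 'I_n.+1 -> C) v : v \in Vs p.2 ->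
    upds (fun=> c) (Vs p.2) (map f' t) v = f' (nth ord0 t (index v (Vs p.2))).
  move=> vV; rewrite (upds_nth _ c) ?wf_uniq ?size_map ?size_tuple //.
  by rewrite (nth_map ord0) // size_tuple index_mem.
by rewrite !U.
Qed.

Lemma sos_quotient_vanishes g h gs hs :
  inF0 g -> all inF gs -> all inF hs ->
  eqA g (funlabel (sumsq gs)) -> eqA h (funlabel (sumsq hs)) ->
  (size (sos_labs gs) <= L)%N -> (size (sos_labs hs) <= L)%N ->
  eqA (fmul g witness) h ->
  jev rW ord0 (index_enum 'I_n.+1) w 0 0 g = 0.
Proof.
move=> g0 wgs whs eg eh Lg Lh egx; rewrite -EV_at1; last exact: sub_inF0.
have [p hp] := EV_poly g; have [q hq] := EV_poly witness.
have q0 : q.[0] < 0.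
  rewrite -hq /EV subr0 mul1r.
  have -> : (fun j => 0 * w j) = (fun=> 0) by apply: functional_extensionality => j; rewrite mul0r.
  apply: witness_neg => //; have := mass1 0; rewrite subr0 mul1r.
  by have -> : (fun j => 0 * w j) = (fun=> 0) by apply: functional_extensionality => j; rewrite mul0r.
have [d /andP[d0 d1] hd] := poly_neg_near0 q0.
suff p0 : p = 0 by rewrite hp p0 horner0.
apply: (@poly_eq0_infinite _ (fun k => d / k.+1%:R)).
  move=> i j /(mulfI (lt0r_neq0 d0)) /invr_inj /eqP.
  by rewrite eqr_nat eqSS => /eqP.
move=> k; set s := d / _.
have s0 : 0 <= s by rewrite divr_ge0 // ltW.
have sd : s <= d by rewrite ler_pdivrMr ?ltr0n // ler_peMr ?ler1n // ltW.
have s01 : 0 <= s <= 1 by rewrite s0 (le_trans sd).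
have G0 : 0 <= p.[s] by rewrite -hp; apply: EV_sos eg.
have W0 : q.[s] < 0 by apply: hd; rewrite s0.
(* The product is the value of the sum of squares [h]; since the witness is negative at [s], the
   nonnegative [p.[s]] can only be zero. *)
have : 0 <= p.[s] * q.[s].
  rewrite -hp -hq /EV -jev_fmul ?inF0_witness //.
  rewrite (jev_eqA _ (relB_sym symW) (mass1 s) egx).
  exact: (EV_sos s01 whs Lh eh).
rewrite (nmulr_lge0 _ W0) => G1; apply/eqP; by rewrite eq_le G1 G0.
Qed.

End KeyArgument.

(** * Graph densities separate the quotient algebra *)

Local Arguments coef : simpl never.

Definition comb (cs : seq (R * gen)) (H : pgraph) : R :=
  \sum_(c <- cs) c.1 * coef (gen_vec c.2) H.

Lemma eqAP f g : eqA f g <->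
  exists cs, List.Forall (fun c => gen_ok c.2) cs /\
    forall H, coef f H - coef g H = comb cs H.
Proof.
have E cs H : foldr (fun c acc => Rplus (Rmult c.1 (coef (gen_vec c.2) H)) acc) 0 cs
    = comb cs H.
  by elim: cs => [|c cs IH]; rewrite /comb ?big_nil // big_cons /= IH.
split=> -[cs [h1 h2]]; exists cs; split=> // H; first by rewrite -E; apply: h2.
exact: etrans (h2 H) (esym (E cs H)).
Qed.

Lemma eqA_refl f : eqA f f.
Proof. by apply/eqAP; exists [::]; split=> [//|H]; rewrite subrr /comb big_nil. Qed.

Lemma eqA_trans f g h : eqA f g -> eqA g h -> eqA f h.
Proof.
move=> /eqAP[c1 [o1 e1]] /eqAP[c2 [o2 e2]]; apply/eqAP; exists (c1 ++ c2).
split; first exact/List.Forall_app.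
by move=> H; rewrite /comb big_cat /= -/(comb _ _) -/(comb _ _) -e1 -e2; ring.
Qed.

Lemma eqA_cat f f' g g' : eqA f f' -> eqA g g' -> eqA (f ++ g) (f' ++ g').
Proof.
move=> /eqAP[c1 [o1 e1]] /eqAP[c2 [o2 e2]]; apply/eqAP; exists (c1 ++ c2).
split; first exact/List.Forall_app.
by move=> H; rewrite /comb big_cat /= -/(comb _ _) -/(comb _ _) -e1 -e2 !coef_cat; ring.
Qed.

Lemma coef_cons p f H : coef (p :: f) H = (if p.2 == H then p.1 else 0) + coef f H.
Proof. by []. Qed.

Lemma coef_nil H : coef [::] H = 0.
Proof. by []. Qed.

Lemma coef_pair H1 H2 H :
  coef [:: (R1, H1); (Ropp R1, H2)] H = (H1 == H)%:R - (H2 == H)%:R.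
Proof.
rewrite !coef_cons coef_nil RoppE -[R1]/(1 : R) /=.
by do 2!case: (_ == H); rewrite /= ?(mulr1n, mulr0n); ring.
Qed.

Definition K1 : pgraph := ([:: 0%N], [::], [::]).

Lemma eqA_pad c H : wf H -> eqA [:: (c, H)] [:: (c, pprod K1 H)].
Proof.
move=> wfH; apply/eqAP; exists [:: (- c, GK K1 H)]; split; first by do !constructor.
move=> H'; rewrite /comb big_seq1 [coef (gen_vec _) _]coef_pair !coef_cons !coef_nil.
by do 2!case: (_ == H'); rewrite /= ?(mulr1n, mulr0n); ring.
Qed.

(** Isolated vertices may be added in the quotient, so all terms can be given the same number [N] of
    vertices. Densities are then homogeneous of one degree in the vertex weights. *)
Definition sized (N : nat) (p : R * pgraph) :=
  [&& wf p.2, Ls p.2 == [::] & size (Vs p.2) == N].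

Lemma eqA_sized1 c H N : wf H -> Ls H = [::] -> (size (Vs H) <= N)%N ->
  exists2 p, sized N p & eqA [:: (c, H)] [:: p].
Proof.
move: {2}(N - _)%N (erefl (N - size (Vs H))%N) => k.
elim: k H => [|k IH] H ek wfH lH sH.
  exists (c, H); last exact: eqA_refl.
  by rewrite /sized /= wfH lH eqxx /= eqn_leq sH; lia.
have s1 : size (Vs (pprod K1 H)) = (size (Vs H)).+1.
  rewrite /Vs /= size_map size_filter; congr _.+1; apply/eqP; rewrite -all_count.
  by apply/allP => v _; rewrite /unmatched /getlab lH.
have [||||p hp ep] := IH (pprod K1 H).
- by rewrite s1; lia.
- exact: wf_pprod.
- exact: Ls_pprod0.
- by rewrite s1; lia.
by exists p => //; apply: eqA_trans ep; apply: eqA_pad.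
Qed.

Lemma eqA_sized f N : inF0 f -> all (fun p => size (Vs p.2) <= N)%N f ->
  exists2 g, all (sized N) g & eqA f g.
Proof.
elim: f => [|[c H] f IH] /=; first by exists [::] => //; apply: eqA_refl.
move=> /andP[/andP[wH /eqP lH] wf] /andP[sH sf].
have [g hg eg] := IH wf sf; have [p hp ep] := eqA_sized1 c wH lH sH.
by exists (p :: g); rewrite /= ?hp //; apply: (eqA_cat ep eg).
Qed.

Lemma eqA_collect (P : pred (R * pgraph)) f H0 : wf H0 ->
  (forall p, p \in f -> P p -> wf p.2 /\ pl_iso p.2 H0) ->
  eqA f ((\sum_(p <- f | P p) p.1, H0) :: [seq p <- f | ~~ P p]).
Proof.
move=> wf0 hP; apply/eqAP; exists [seq (p.1, GIso p.2 H0) | p <- f & P p]; split.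
  elim: f hP => //= p f IH hP; case: (boolP (P p)) => Pp /=.
    constructor; last by apply: IH => q qf; apply: hP; rewrite inE qf orbT.
    by have [] := hP p (mem_head _ _) Pp.
  by apply: IH => q qf; apply: hP; rewrite inE qf orbT.
move=> H; rewrite /comb big_map big_filter.
under eq_bigr do rewrite [coef (gen_vec _) _]coef_pair.
elim: f {hP} => [|p f IH].
  by rewrite !big_nil !coef_cons coef_nil /=; case: (_ == H); ring.
rewrite !big_cons [filter _ _]/=; move: IH; case: (P p) => /=; rewrite !coef_cons /=;
  case: (H0 == H); case: (p.2 == H) => /= IH; rewrite ?(mulr1n, mulr0n); lra.
Qed.

Section Separation.
Variable n : nat.
Local Notation N := n.+1.

(* Homomorphisms to a graph on ['I_N] written as the tuple of the images of
   the vertices of [H], in the order of [Vs H]. *)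
Definition thom (r : rel 'I_N) (H : pgraph) (t : seq 'I_N) : bool :=
  all (fun e => r (nth ord0 t (index e.1 (Vs H))) (nth ord0 t (index e.2 (Vs H)))) (Es H).

Definition wdens (r : rel 'I_N) (w : 'I_N -> R) (H : pgraph) : R :=
  \sum_(t : (size (Vs H)).-tuple 'I_N) (\prod_(j <- t) w j) * (thom r H t)%:R.

Lemma jdens_wdens r w H : wf H ->
  jdens r ord0 (index_enum 'I_N) w 0 0 H = wdens r w H.
Proof.
move=> wfH; rewrite /jdens (@jint_tuple _ _ _ _ _ w id) //.
apply: eq_bigr => t _; congr (_ * _); congr (nat_of_bool _)%:R.
apply: eq_in_all => e /(allP (wf_edges wfH))/andP[h1 h2].
have U v : v \in Vs H ->
    upds (fun=> inl ord0) (Vs H) [seq inl j | j <- t] v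
    = inl (nth ord0 t (index v (Vs H))) :> 'I_N + nat.
  move=> vV; rewrite (upds_nth _ (inl ord0)) ?wf_uniq ?size_map ?size_tuple //.
  by rewrite (nth_map ord0) // size_tuple index_mem.
by rewrite !U.
Qed.

Definition covers (t : seq 'I_N) : bool := [forall j, j \in t].

(** Surjective homomorphism numbers. Between graphs with [N] vertices they are triangular with
    respect to the number of edges. *)
Definition sdens (r : rel 'I_N) (H : pgraph) : R :=
  \sum_(t : (size (Vs H)).-tuple 'I_N) (covers t && thom r H t)%:R.

(** The sum over [T] factors over the points: [i] contributes [-1] if put into [T], and otherwise 1
    or 0 as it is missed or met by [t]. The factor is thus 0 for a missed point and [-1] for a met
    one. *)
Lemma incl_excl (t : seq 'I_N) :
  \sum_(T : {set 'I_N}) (\prod_i (if i \in T then -1 else 1)) * \prod_(j <- t) (j \in T)%:R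
  = (-1) ^+ N * (covers t)%:R :> R.
Proof.
transitivity (\sum_(T : {set 'I_N}) \prod_i (if i \in T then -1 else (i \notin t)%:R) : R).
  apply: eq_bigr => T _; case: (boolP (all (mem T) t)) => [/allP tT|/allPn[j jt jT]].
    rewrite [X in _ * X]big_seq [X in _ * X]big1 => [|j /tT /= -> //]; rewrite mulr1.
    apply: eq_bigr => i _; case: (boolP (i \in T)) => // iT.
    by case: (boolP (i \in t)) => // /tT; rewrite /= (negbTE iT).
  have {}jT : (j \in T) = false by apply/negbTE.
  rewrite [X in _ * X](big_rem j) //= jT mul0r mulr0.
  by rewrite (bigD1 j) //= jT jt mul0r.
rewrite -(@bigA_distr _ _ _ _ _ _ (fun=> -1 : R) (fun i => (i \notin t)%:R)).
have [/forallP c|/forallPn[j jt]] := boolP (covers t); last first.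
  by rewrite mulr0 (bigD1 j) //= jt addNr mul0r.
rewrite mulr1 (eq_bigr (fun=> -1)) => [|i _]; last by rewrite c; apply: addr0.
by rewrite prodr_const card_ord.
Qed.

Lemma sdens_wdens r H :
  \sum_(T : {set 'I_N}) (\prod_i (if i \in T then -1 else 1))
     * wdens r (fun j => (j \in T)%:R) H = (-1) ^+ N * sdens r H.
Proof.
under eq_bigr do rewrite mulr_sumr.
rewrite exchange_big /= mulr_sumr; apply: eq_bigr => t _.
under eq_bigr do rewrite mulrA.
by rewrite -mulr_suml incl_excl -mulrA -natrM mulnb.
Qed.

Definition vanishes (f : fsum) :=
  forall (r : rel 'I_N) (w : 'I_N -> R), symmetric r -> (forall j, 0 <= w j) ->
    \sum_j w j = 1 -> jev r ord0 (index_enum 'I_N) w 0 0 f = 0.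

Lemma vanishes_eqA f g : eqA f g -> vanishes f -> vanishes g.
Proof.
move=> e hf r w sr w0 w1; rewrite -[RHS](hf r w sr w0 w1); apply/esym.
by apply: jev_eqA => //; rewrite mul0r addr0.
Qed.

(** Uniform weights on a nonempty set [T] give the homomorphism counts into [T], the factor
    [#|T| ^- N] being common to all terms. Inclusion-exclusion over [T] leaves the surjective
    ones. *)
Lemma vanishes_sdens f r : symmetric r -> all (sized N) f -> vanishes f ->
  \sum_(p <- f) p.1 * sdens r p.2 = 0.
Proof.
move=> sr /allP sf hf.
have hT (T : {set 'I_N}) : \sum_(p <- f) p.1 * wdens r (fun j => (j \in T)%:R) p.2 = 0.
  have [->|[j0 j0T]] := set_0Vmem T.
    rewrite big_seq big1 // => p /sf /and3P[_ _ /eqP sp].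
    rewrite /wdens big1 ?mulr0 // => t _.
    case: t => -[|j s] /=; first by rewrite sp.
    by move=> _; rewrite big_cons inE !mul0r.
  have T0 : (0 : R) < #|T|%:R by rewrite ltr0n card_gt0; apply/set0Pn; exists j0.
  pose w (j : 'I_N) : R := (j \in T)%:R / #|T|%:R.
  have w1 : \sum_j w j = 1.
    rewrite -mulr_suml -natr_sum -[X in X%:R](_ : #|T| = _) ?divff ?gt_eqF //.
    by rewrite -sum1_card big_mkcond; apply: eq_bigr => j _; case: (j \in T).
  have w0 j : 0 <= w j by rewrite divr_ge0 ?ler0n.
  have := hf r w sr w0 w1; rewrite /jev.
  have -> : \sum_(p <- f) p.1 * jdens r ord0 (index_enum 'I_N) w 0 0 p.2
      = #|T|%:R ^- N * \sum_(p <- f) p.1 * wdens r (fun j => (j \in T)%:R) p.2.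
    rewrite mulr_sumr big_seq [RHS]big_seq; apply: eq_bigr => p /sf /and3P[wp _ /eqP sp].
    rewrite jdens_wdens // mulrCA; congr (_ * _); rewrite mulr_sumr.
    apply: eq_bigr => t _; rewrite mulrA; congr (_ * _).
    rewrite big_split /= mulrC; congr (_ * _).
    by rewrite big_const_seq count_predT size_tuple iter_mulr_1 sp exprVn.
  by move/eqP; rewrite mulf_eq0 invr_eq0 expf_eq0 /= gt_eqF //= => /eqP.
have : \sum_(T : {set 'I_N}) (\prod_i (if i \in T then -1 else 1))
    * \sum_(p <- f) p.1 * wdens r (fun j => (j \in T)%:R) p.2 = 0 :> R.
  by rewrite big1 // => T _; rewrite hT mulr0.
under eq_bigr do rewrite mulr_sumr.
rewrite exchange_big /= => h.
have : (-1) ^+ N * \sum_(p <- f) p.1 * sdens r p.2 = 0 :> R.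
  rewrite -[RHS]h mulr_sumr; apply: eq_bigr => p _.
  by rewrite mulrCA -sdens_wdens mulr_sumr; apply: eq_bigr => T _; rewrite mulrCA.
by move/eqP; rewrite mulf_eq0 signr_eq0 => /eqP.
Qed.

Definition gadj (H : pgraph) : rel 'I_N :=
  fun a b => adj H (nth 0%N (Vs H) a) (nth 0%N (Vs H) b).

Lemma gadj_sym H : symmetric (gadj H).
Proof. by move=> a b; rewrite /gadj /adj orbC. Qed.

Definition gedges (H : pgraph) : {set 'I_N * 'I_N} := [set c | gadj H c.1 c.2].

Lemma sdens_self H : wf H -> size (Vs H) = N -> 0 < sdens (gadj H) H.
Proof.
move=> wfH sH.
have st : size (enum 'I_N) == size (Vs H) by rewrite size_enum_ord sH.
rewrite /sdens (bigD1 (Tuple st)) //=; apply: ltr_wpDr; first by apply: sumr_ge0 => *; apply: ler0n.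
rewrite ltr0n lt0b; apply/andP; split; first by apply/forallP => j; rewrite mem_enum.
apply/allP => -[u v] i; have /andP[/= uV vV] := allP (wf_edges wfH) _ i.
have I w : w \in Vs H -> nth 0%N (Vs H) (nth ord0 (enum 'I_N) (index w (Vs H))) = w.
  by move=> wV; rewrite nth_enum_ord ?nth_index // -sH index_mem.
by rewrite /gadj /= !I // /adj i.
Qed.

(** A surjection between vertex sets of size [N] is a bijection, and it maps edges injectively to
    edges. As [H0] has no more edges than [H], every edge of [H0] is hit, so nonadjacency is
    preserved as well. *)
Lemma sdens_iso H H0 : wf H -> wf H0 -> Ls H = [::] -> Ls H0 = [::] ->
  size (Vs H) = N -> size (Vs H0) = N -> (#|gedges H0| <= #|gedges H|)%N ->
  sdens (gadj H0) H != 0 -> pl_iso H H0.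
Proof.
move=> wfH wf0 lH l0 sH s0 ec.
have [t /andP[ct ht] _|h] := pickP (fun t : (size (Vs H)).-tuple 'I_N => covers t && thom (gadj H0) H t);
  last by rewrite /sdens big1 ?eqxx // => t _; rewrite h.
have st : size t = N by rewrite size_tuple sH.
have ut : uniq t.
  apply: (@leq_size_uniq _ (enum 'I_N)); rewrite ?enum_uniq ?size_enum_ord ?st //.
  by move=> j _; apply: (forallP ct).
pose tau (a : 'I_N) := nth ord0 t a.
have tau_inj : injective tau.
  move=> a b /eqP; rewrite nth_uniq ?st //; by move/eqP/val_inj.
have iV v : v \in Vs H -> (index v (Vs H) < N)%N by rewrite -index_mem sH.
pose io v : 'I_N := inord (index v (Vs H)).
have ioE v : v \in Vs H -> nth 0%N (Vs H) (io v) = v.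
  by move=> vV; rewrite inordK ?iV // nth_index.
pose f v := nth 0%N (Vs H0) (nth ord0 t (index v (Vs H))).
have fE v : v \in Vs H -> f v = nth 0%N (Vs H0) (tau (io v)).
  by move=> vV; rewrite /f /tau inordK ?iV.
pose tt (c : 'I_N * 'I_N) := (tau c.1, tau c.2).
have tt_inj : injective tt by move=> [a b] [c d] [/tau_inj-> /tau_inj->].
have hom u v : u \in Vs H -> v \in Vs H -> adj H u v -> adj H0 (f u) (f v).
  by move=> uV vV /orP[] /(allP ht) //=; rewrite gadj_sym.
have im : tt @: gedges H = gedges H0.
  apply/eqP; rewrite eqEcard card_imset // ec andbT; apply/subsetP => _ /imsetP[[a b] + ->].
  rewrite !inE /gadj /= => hab.
  have aV (c : 'I_N) : nth 0%N (Vs H) c \in Vs H by rewrite mem_nth ?sH.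
  have ioK (c : 'I_N) : io (nth 0%N (Vs H) c) = c.
    by apply: val_inj; rewrite /= inordK ?index_uniq ?wf_uniq ?sH //.
  by have := hom _ _ (aV a) (aV b) hab; rewrite !fE // !ioK.
exists f; split.
- have -> : map f (Vs H) = map (nth 0%N (Vs H0)) (map val t).
    rewrite -map_comp; apply: (@eq_from_nth _ 0%N); first by rewrite !size_map st sH.
    move=> i; rewrite size_map => iV'; have iN : (i < N)%N by rewrite -sH.
    rewrite (nth_map 0%N) // (nth_map ord0) ?st //= /f.
    by rewrite index_uniq ?wf_uniq.
  apply: (@perm_trans _ (map (nth 0%N (Vs H0)) (map val (enum 'I_N)))).
    do 2!apply: perm_map; apply: uniq_perm => //; first exact: enum_uniq.
    by move=> j; rewrite mem_enum; apply: (forallP ct).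
  by rewrite val_enum_ord -s0 map_nth_iota0 // take_size.
- move=> u v uV vV; apply/idP/idP; last exact: hom.
  move=> h; have : tt (io u, io v) \in gedges H0 by rewrite inE /gadj /= -!fE.
  by rewrite -im mem_imset // inE /gadj /= !ioE.
- by move=> v _; rewrite /getlab lH l0.
Qed.

(** When tested on a term with the fewest edges, only terms isomorphic to it survive. They are
    merged into one, whose coefficient must vanish, and the remaining shorter sum is treated by
    induction. *)
Lemma vanishes_eq0 f : all (sized N) f -> vanishes f -> eqA f fzero.
Proof.
move: {2}(size f).+1 (ltnSn (size f)) => m; elim: m f => // m IH f.
rewrite ltnS => sm sf hf.
case: f sm sf hf => [|p0 f'] sm sf hf; first exact: eqA_refl.
set f := p0 :: f' in sm sf hf *.
have [p1 p1f hmin] : exists2 p1, p1 \in f & {in f, forall p, #|gedges p1.2| <= #|gedges p.2|}%N.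
  have hex : exists k, has (fun p => #|gedges p.2| == k) f by exists #|gedges p0.2|; rewrite /= eqxx.
  case: (ex_minnP hex) => k /hasP[p pf /eqP kE] hk; exists p => // q qf.
  by rewrite kE; apply: hk; apply/hasP; exists q.
have /and3P[w1 /eqP l1 /eqP s1] := allP sf _ p1f.
pose P (p : R * pgraph) := sdens (gadj p1.2) p.2 != 0.
have P1 : P p1 by rewrite /P gt_eqF // sdens_self.
have e : eqA f ((\sum_(p <- f | P p) p.1, p1.2) :: [seq p <- f | ~~ P p]).
  apply: eqA_collect => // p pf Pp.
  have /and3P[w /eqP l /eqP s] := allP sf _ pf; split=> //.
  by apply: sdens_iso => //; apply: hmin.
have sf2 : all (sized N) [seq p <- f | ~~ P p].
  by apply/allP => p; rewrite mem_filter => /andP[_]; apply: (allP sf).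
have v2 := vanishes_eqA e hf.
have c0 : \sum_(p <- f | P p) p.1 = 0.
  have : \sum_(p <- (\sum_(p <- f | P p) p.1, p1.2) :: [seq p <- f | ~~ P p])
      p.1 * sdens (gadj p1.2) p.2 = 0.
    apply: vanishes_sdens => //; first exact: gadj_sym.
    by rewrite /= sf2 andbT /sized /= w1 l1 s1 !eqxx.
  rewrite big_cons big_filter [X in _ + X]big1 ?addr0 => [|p]; last by rewrite /P negbK => /eqP ->; rewrite mulr0.
  by move/eqP; rewrite mulf_eq0 (negbTE P1) orbF => /eqP.
have e2 : eqA f [seq p <- f | ~~ P p].
  apply: eqA_trans e _; apply/eqAP; exists [::]; split=> // H.
  by rewrite coef_cons /comb big_nil /= c0; case: (p1.2 == H); ring.
apply: (eqA_trans e2); apply: IH => //; last exact: vanishes_eqA e2 hf.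
apply: leq_trans sm; rewrite size_filter -(count_predC P f) -[X in (X < _)%N]add0n ltn_add2r.
by rewrite -has_count; apply/hasP; exists p1.
Qed.

End Separation.

Theorem theorem2p4 :
  exists x : fsum,
    inF0 x /\ positive0 x /\
    ~ (exists g h : fsum,
         inF0 g /\ inF0 h /\ is_sos g /\ is_sos h /\
         ~ eqA g fzero /\ eqA (fmul g x) h).
Proof.
exists witness; split; first exact: inF0_witness.
split; first exact: positive0_witness.
move=> [g [h [g0 [h0 [[gs [wgs eg]] [[hs [whs eh]] [gn0 egx]]]]]]].
apply: gn0; pose n := \max_(p <- g) size (Vs p.2).
have [g' sg' eg'] : exists2 g', all (sized n.+1) g' & eqA g g'.
  apply: eqA_sized => //; apply/allP => p pg.
  by apply: leqW; rewrite /n (big_rem p) //= leq_maxl.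
apply: (eqA_trans eg'); apply: (vanishes_eq0 sg').
apply: (vanishes_eqA eg') => r w sr w0 w1.
(* [L] bounds the number of labels in both sums of squares; the successor makes it positive. *)
pose L := (size (sos_labs gs) + size (sos_labs hs)).+1.
by apply: (@sos_quotient_vanishes n r w sr w0 w1 L isT g h gs hs) => //; rewrite /L; lia.
Qed.
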